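(* There is a polynomial-time algorithm for the minimum-diameter $k$-tree problem on graphs with nonnegative edge weights: given an undirected graph with nonnegative edge weights and a positive integer $k$, find a tree (a subgraph) of minimum diameter spanning at least $k$ nodes.
   Context: The diameter of an edge-weighted tree is the maximum, over all pairs of nodes in the tree, of the weighted length of the path between them in the tree. *)

(* Defs.v *)
From mathcomp Require Import all_boot all_order all_algebra.

Set Implicit Arguments.
Unset Strict Implicit.
Unset Printing Implicit Defensive.

Import GRing.Theory Num.Theory.

(** * Random access machines with logarithmic cost

  The machine has a memory of cells indexed by [nat], each holding a natural
  number of unbounded size.  Programs are structured (while-programs), with
  indirect addressing and the operations + - * / of Aho, Hopcroft and Ullman.
  An operation is charged the bit length of each of its operands, addresses
  included, so that polynomial time here is polynomial time on a Turing
  machine. *)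

Inductive binop := Add | Sub | Mul | Div.

Inductive expr :=
  | Const of nat
  | Cell of expr
  | Bin of binop & expr & expr.

Inductive prog :=
  | Skip
  | Store of expr & expr
  | Seq of prog & prog
  | If of expr & prog & prog
  | While of expr & prog.

Definition memory := nat -> nat.

(* Bit length, with [bitlen 0 = bitlen 1 = 1]. *)
Definition bitlen (v : nat) : nat := (trunc_log 2 v).+1.

(* [Sub] is truncated, and division by zero yields 0. *)
Definition binop_fun (o : binop) : nat -> nat -> nat :=
  match o with
  | Add => addn
  | Sub => subn
  | Mul => muln
  | Div => divn
  end.

Fixpoint eval (m : memory) (e : expr) : nat :=
  match e with
  | Const v => v
  | Cell a => m (eval m a)
  | Bin o e1 e2 => binop_fun o (eval m e1) (eval m e2)
  end.

Fixpoint eval_cost (m : memory) (e : expr) : nat :=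
  match e with
  | Const v => bitlen v
  | Cell a => eval_cost m a + bitlen (eval m a) + bitlen (m (eval m a))
  | Bin _ e1 e2 =>
      eval_cost m e1 + eval_cost m e2
      + bitlen (eval m e1) + bitlen (eval m e2)
  end.

Definition update (m : memory) (a v : nat) : memory :=
  fun b => if b == a then v else m b.

(* [exec c m t m']: started in memory [m], the program [c] halts at cost [t]
   in memory [m']. *)
Inductive exec : prog -> memory -> nat -> memory -> Prop :=
  | ExecSkip m :
      exec Skip m 1 m
  | ExecStore m a e :
      exec (Store a e) m
        (eval_cost m a + eval_cost m e + bitlen (eval m a) + bitlen (eval m e))
        (update m (eval m a) (eval m e))
  | ExecSeq c1 c2 m1 m2 m3 t1 t2 :
      exec c1 m1 t1 m2 -> exec c2 m2 t2 m3 ->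
      exec (Seq c1 c2) m1 (t1 + t2) m3
  | ExecIfTrue e c1 c2 m m' t :
      eval m e != 0 -> exec c1 m t m' ->
      exec (If e c1 c2) m (eval_cost m e + bitlen (eval m e) + t) m'
  | ExecIfFalse e c1 c2 m m' t :
      eval m e = 0 -> exec c2 m t m' ->
      exec (If e c1 c2) m (eval_cost m e + bitlen (eval m e) + t) m'
  | ExecWhileTrue e c m1 m2 m3 t1 t2 :
      eval m1 e != 0 -> exec c m1 t1 m2 -> exec (While e c) m2 t2 m3 ->
      exec (While e c) m1 (eval_cost m1 e + bitlen (eval m1 e) + t1 + t2) m3
  | ExecWhileFalse e c m :
      eval m e = 0 ->
      exec (While e c) m (eval_cost m e + bitlen (eval m e)) m.

(* The input word is placed in cells 0, 1, 2, ...; all other cells are 0. *)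
Definition load (s : seq nat) : memory := nth 0 s.

(* The output word is read from cells 0, 1, 2, ... *)
Definition holds (m : memory) (s : seq nat) : Prop :=
  forall i, i < size s -> m i = nth 0 s i.

Definition bit_size (s : seq nat) : nat := \sum_(v <- s) bitlen v.

(* [encode] writes an instance as a word and [answer x s] says that the word
   [s] is a correct answer to [x]. *)
Definition poly_time_solvable (I : Type) (encode : I -> seq nat)
    (answer : I -> seq nat -> Prop) : Prop :=
  exists (c : prog) (p : {poly nat}), forall x : I,
    exists (t : nat) (m : memory) (s : seq nat),
      [/\ exec c (load (encode x)) t m,
          t <= p.[bit_size (encode x)]%R,
          holds m s
        & answer x s].

(* The values of [weight] outside the edges are irrelevant. *)
Record wgraph (n : nat) := WGraph {
  edge : rel 'I_n;
  weight : 'I_n -> 'I_n -> rat;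
  edge_sym : symmetric edge;
  edge_irr : irreflexive edge;
  weight_sym : forall x y, edge x y -> weight x y = weight y x;
  weight_ge0 : forall x y, edge x y -> (0 <= weight x y)%R
}.

Record subgraph (n : nat) := Subgraph {
  nodes : {set 'I_n};
  links : rel 'I_n
}.

Section Trees.
Variable n : nat.
Implicit Types (G : wgraph n) (T : subgraph n) (x y : 'I_n).

Definition is_subgraph G T : Prop :=
  symmetric (links T) /\
  forall x y, links T x y -> [&& edge G x y, x \in nodes T & y \in nodes T].

Definition connected T : Prop :=
  nodes T != set0 /\ {in nodes T &, forall x y, connect (links T) x y}.

Definition acyclic T : Prop :=
  forall c : seq 'I_n, 2 < size c -> ~ ucycle (links T) c.

Definition is_tree T : Prop := connected T /\ acyclic T.

(* [x :: p] is a simple path of [T] from [x] to [y]; when [T] is a tree there is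
   exactly one such [p] for all nodes [x] and [y]. *)
Definition path_between T x y (p : seq 'I_n) : Prop :=
  [/\ path (links T) x p, last x p = y & uniq (x :: p)].

Definition path_length G x (p : seq 'I_n) : rat :=
  (\sum_(a <- pairmap (weight G) x p) a)%R.

Definition is_diameter G T (d : rat) : Prop :=
  (exists x y p, [/\ x \in nodes T, y \in nodes T, path_between T x y p
                   & path_length G x p = d]) /\
  (forall x y p, x \in nodes T -> y \in nodes T -> path_between T x y p ->
     (path_length G x p <= d)%R).

Definition is_ktree G (k : nat) T : Prop :=
  [/\ is_subgraph G T, is_tree T & k <= #|nodes T|].

Definition is_min_diameter_ktree G (k : nat) T : Prop :=
  is_ktree G k T /\
  exists2 d, is_diameter G T d &
    forall T' d', is_ktree G k T' -> is_diameter G T' d' -> (d <= d')%R.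

End Trees.

Record ktree_instance := KTreeInstance {
  node_count : nat;
  graph : wgraph node_count;
  bound : nat;
  bound_gt0 : 0 < bound
}.

(* Adjacency matrix in row-major order, two cells per entry: numerator and
   denominator (in lowest terms) of the weight, or 0 0 if there is no edge. *)
Definition encode_wgraph (n : nat) (G : wgraph n) : seq nat :=
  flatten [seq (if edge G i j then [:: `|numq (weight G i j)|%N;
                                       `|denq (weight G i j)|%N]
                else [:: 0; 0]) | i <- enum 'I_n, j <- enum 'I_n].

Definition encode_instance (I : ktree_instance) : seq nat :=
  [:: node_count I, bound I & encode_wgraph (graph I)].

(* Characteristic vector of the nodes, then adjacency matrix. *)
Definition encode_subgraph (n : nat) (T : subgraph n) : seq nat :=
  [seq (i \in nodes T : nat) | i <- enum 'I_n] ++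
  [seq (links T i j : nat) | i <- enum 'I_n, j <- enum 'I_n].

(* The word [:: 0] reports that no tree of the graph has at least [bound I]
   nodes. *)
Definition ktree_answer (I : ktree_instance) (s : seq nat) : Prop :=
  (exists2 T : subgraph (node_count I),
     is_min_diameter_ktree (graph I) (bound I) T
     & s = 1 :: encode_subgraph T) \/
  ((forall T : subgraph (node_count I), ~ is_ktree (graph I) (bound I) T)
   /\ s = [:: 0]).

(* Main.v *)
Require Import Defs.
From mathcomp Require Import all_boot all_order all_algebra zify.
From Stdlib Require Import FunctionalExtensionality Classical.

Set Implicit Arguments.
Unset Strict Implicit.
Unset Printing Implicit Defensive.

Import Order.TTheory GRing.Theory Num.Theory.

(** A tree of diameter [d] has a center: a point of some edge [uv] within
  distance [d/2] of all its nodes.  Deleting [uv] splits the tree into the side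
  of [u], of radius [a] around [u], and the side of [v], of radius [b] around
  [v], with [a + b + w(uv), 2a, 2b <= d].  Conversely, put [D = max ((a + b +
  w(uv)) / 2, a, b)] and grow a tree from the edge [uv] by Dijkstra's rule,
  with initial labels [D - a] at [u] and [D - b] at [v] and admitting labels up
  to [D].  Since the two initial labels sum to at least [w(uv)], an induction
  on the number of leaves added bounds the distance of two nodes by the sum of
  their labels, hence the diameter by [2D]; and the tree contains every node
  that is reached from [u] within [a] or from [v] within [b].  The radii worth
  trying are the distances from [u] in the graph without [v] and from [v] in
  the graph without [u], which the same procedure computes.  Weights are
  cleared of denominators and doubled, so that [d/2] is an integer.

  The running time is bounded by a syntactic criterion: in programs whose loops
  all have [n] iterations and whose products all have a factor in the input,
  each assignment increases the bit length of the memory contents by at most a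
  constant times the size of the input. *)

(** * Polynomial time for programs with bounded loops *)

(** The sides of an optimal tree are unknown, and the nodes within [a] of [u] may overlap those
    within [b] of [v], so shortest path trees of the two sides cannot simply be joined: their union
    could contain cycles. A single run of Dijkstra's rule from both ends attaches every node once.
    It may attach a node on the other side than the optimal tree does, which is harmless because
    only the labels enter the diameter bound. The tree found need not have diameter exactly [2D];
    minimality is a comparison: its diameter is at most the recorded [2D], which in turn is at most
    the diameter of every competitor. On the machine, counting instructions is not enough: under
    logarithmic cost, repeated squaring produces numbers of exponential length in linearly many
    steps. Bit lengths are therefore bounded together with the steps, in a small loop language that
    is compiled to the machine. *)

Lemma ltn_pow2_bitlen v : v < 2 ^ bitlen v.
Proof. exact: trunc_log_ltn. Qed.

Lemma bitlen_leq v b : 0 < b -> v < 2 ^ b -> bitlen v <= b.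
Proof.
case: v => [|v] b0 vb; first by rewrite /bitlen trunc_log0.
rewrite /bitlen; have := trunc_logP (isT : 1 < 2) (ltn0Sn v) => h.
by rewrite -(ltn_exp2l _ _ (isT : 1 < 2)); apply: leq_ltn_trans vb.
Qed.

(** Factor by which an expression can multiply the bit length of the memory cells. A cell has width
    1 whatever its address; [v.+1] crudely bounds the length of a constant, as [v < 2 ^ v]. *)
Fixpoint expr_width (e : expr) : nat :=
  match e with
  | Const v => v.+1
  | Cell _ => 1
  | Bin _ e1 e2 => expr_width e1 + expr_width e2
  end.

Fixpoint expr_cost (e : expr) : nat :=
  match e with
  | Const v => v.+1
  | Cell a => expr_cost a + expr_width a + 1
  | Bin _ e1 e2 => expr_cost e1 + expr_cost e2 + expr_width e1 + expr_width e2
  end.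

Section ExprBound.
Variables (m : memory) (b : nat).
Hypotheses (b_gt0 : 0 < b) (m_lt : forall a, m a < 2 ^ b).

Lemma expr_width_gt0 e : 0 < expr_width e.
Proof. by elim: e => //= _ e1 h1 e2 h2; rewrite addn_gt0 h1. Qed.

Lemma eval_lt e : eval m e < 2 ^ (b * expr_width e).
Proof.
elim: e => [v|a _|o e1 h1 e2 h2] /=.
- apply: (leq_trans (ltn_expl v (isT : 1 < 2))).
  by rewrite leq_exp2l // mulnS -[v in v <= _]add0n leq_add // leq_pmull.
- by rewrite muln1.
- have w1 : 0 < b * expr_width e1 by rewrite muln_gt0 b_gt0 expr_width_gt0.
  have w2 : 0 < b * expr_width e2 by rewrite muln_gt0 b_gt0 expr_width_gt0.
  rewrite mulnDr expnD; move: h1 h2.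
  (* Both bounds are at least 2, so their product is at least their sum; one exponent then serves
     all four operations. *)
  have p1 : 2 <= 2 ^ (b * expr_width e1) by rewrite -{1}(expn1 2) leq_exp2l.
  have p2 : 2 <= 2 ^ (b * expr_width e2) by rewrite -{1}(expn1 2) leq_exp2l.
  move: (2 ^ (b * expr_width e1)) (2 ^ (b * expr_width e2)) p1 p2.
  move: (eval m e1) (eval m e2) => x y P Q P2 Q2 xP yQ.
  have xPQ : x < P * Q by apply: (leq_trans xP); rewrite leq_pmulr //; lia.
  case: o => /=.
  + nia.
  + lia.
  + exact: ltn_mul.
  + exact: leq_ltn_trans (leq_div _ _) xPQ.
Qed.

Lemma bitlen_eval e : bitlen (eval m e) <= b * expr_width e.
Proof. by apply: bitlen_leq (eval_lt e); rewrite muln_gt0 b_gt0 expr_width_gt0. Qed.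

Lemma eval_cost_leq e : eval_cost m e <= b * expr_cost e.
Proof.
elim: e => [v|a h|o e1 h1 e2 h2] /=.
- exact: (bitlen_eval (Const v)).
- rewrite !mulnDr muln1 !leq_add // ?bitlen_eval //.
  exact: bitlen_leq.
- by rewrite !mulnDr !leq_add // bitlen_eval.
Qed.

End ExprBound.

(* Loop variables are de Bruijn indices.  Array 0 is the memory area of the
   input word; the right factor of a product is read from it, so that one
   multiplication adds at most the bit size of the input to the bit length. *)
Inductive hexp :=
  | HConst of nat
  | HVar of nat
  | HIn of hexp
  | HArr of nat & hexp
  | HAdd of hexp & hexp
  | HSub of hexp & hexp
  | HDiv of hexp & hexp
  | HMulIn of hexp & hexp.

(** [COut] is the only way to write array 0 that [cmd_ok] leaves. It stores just 0 or 1 and never at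
    index 0, so input entries stay short and [n] stays readable while the answer overwrites the
    word. *)
Inductive cmd :=
  | CSkip
  | CSet of nat & hexp & hexp
  | COut of hexp & hexp
  | CSeq of cmd & cmd
  | CIf of hexp & cmd & cmd
  | CFor of cmd.

Definition state := nat -> nat -> nat.

Definition upd (s : state) k i v : state :=
  fun k' => if k' == k then update (s k) i v else s k'.

Section Semantics.
Variable n : nat.

(* Clamping the addresses keeps the semantics total: an index beyond the
   input area would meet other arrays in the memory of the machine. *)
Fixpoint ev (env : seq nat) (s : state) (e : hexp) : nat :=
  match e with
  | HConst v => v
  | HVar x => nth 0 env x
  | HIn a => s 0 (minn (ev env s a) (2 * (n * n) + 1))
  | HArr k a => s k (ev env s a)
  | HAdd e1 e2 => ev env s e1 + ev env s e2
  | HSub e1 e2 => ev env s e1 - ev env s e2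
  | HDiv e1 e2 => ev env s e1 %/ ev env s e2
  | HMulIn e1 a => ev env s e1 * s 0 (minn (ev env s a) (2 * (n * n) + 1))
  end.

Fixpoint run (env : seq nat) (c : cmd) (s : state) : state :=
  match c with
  | CSkip => s
  | CSet k a e => upd s k (ev env s a) (ev env s e)
  | COut a e =>
      upd s 0 (1 + minn (ev env s a) (2 * (n * n))) (1 - (1 - ev env s e))
  | CSeq c1 c2 => run env c2 (run env c1 s)
  | CIf e c1 c2 => if ev env s e != 0 then run env c1 s else run env c2 s
  | CFor c => iteri n (fun i => run (i :: env) c) s
  end.

End Semantics.

(** * Compilation of the loop language to the machine *)

Section Compile.
Variable K : nat.

Definition square_cell0 := Bin Mul (Const 2) (Bin Mul (Cell (Const 0)) (Cell (Const 0))).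

(* The free memory begins at [2 + 2n^2], recomputed from [n] in cell 0.  It
   interleaves the arrays: entry [i] of array [k] is at [2 + 2n^2 + iK + k],
   and slot [k = 0] holds the loop counters. *)
Definition array_addr k e :=
  Bin Add (Bin Add (Const 2) square_cell0)
          (Bin Add (Bin Mul e (Const K)) (Const k)).

Definition counter_addr d := array_addr 0 (Const d).

(* [x - (x - y)] is the minimum of [x] and [y]. *)
Definition min_expr x y := Bin Defs.Sub x (Bin Defs.Sub x y).

Definition input_addr e := min_expr e (Bin Add square_cell0 (Const 1)).

Fixpoint comp_exp (d : nat) (e : hexp) : expr :=
  match e with
  | HConst v => Const v
  | HVar x => if x < d then Cell (counter_addr (d - x.+1)) else Const 0
  | HIn a => Cell (input_addr (comp_exp d a))
  | HArr k a => Cell (array_addr k (comp_exp d a))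
  | HAdd e1 e2 => Bin Add (comp_exp d e1) (comp_exp d e2)
  | HSub e1 e2 => Bin Defs.Sub (comp_exp d e1) (comp_exp d e2)
  | HDiv e1 e2 => Bin Div (comp_exp d e1) (comp_exp d e2)
  | HMulIn e1 a => Bin Mul (comp_exp d e1) (Cell (input_addr (comp_exp d a)))
  end.

Definition loop_test d := Bin Defs.Sub (Cell (Const 0)) (Cell (counter_addr d)).
Definition loop_incr d :=
  Store (counter_addr d) (Bin Add (Cell (counter_addr d)) (Const 1)).

Definition out_addr e := Bin Add (Const 1) (min_expr e square_cell0).
Definition bool_expr e := Bin Defs.Sub (Const 1) (Bin Defs.Sub (Const 1) e).

Fixpoint comp (d : nat) (c : cmd) : prog :=
  match c with
  | CSkip => Skip
  | CSet k a e => Store (array_addr k (comp_exp d a)) (comp_exp d e)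
  | COut a e => Store (out_addr (comp_exp d a)) (bool_expr (comp_exp d e))
  | CSeq c1 c2 => Seq (comp d c1) (comp d c2)
  | CIf e c1 c2 => If (comp_exp d e) (comp d c1) (comp d c2)
  | CFor c =>
      Seq (Store (counter_addr d) (Const 0))
          (While (loop_test d) (Seq (comp d.+1 c) (loop_incr d)))
  end.

Fixpoint hexp_ok (e : hexp) : bool :=
  match e with
  | HConst _ | HVar _ => true
  | HIn a => hexp_ok a
  | HArr k a => (0 < k < K) && hexp_ok a
  | HAdd e1 e2 | HSub e1 e2 | HDiv e1 e2 | HMulIn e1 e2 =>
      hexp_ok e1 && hexp_ok e2
  end.

Fixpoint cmd_ok (c : cmd) : bool :=
  match c with
  | CSkip => true
  | CSet k a e => [&& 0 < k < K, hexp_ok a & hexp_ok e]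
  | COut a e => hexp_ok a && hexp_ok e
  | CSeq c1 c2 => cmd_ok c1 && cmd_ok c2
  | CIf e c1 c2 => [&& hexp_ok e, cmd_ok c1 & cmd_ok c2]
  | CFor c => cmd_ok c
  end.

Variable n : nat.
Let S := 2 + 2 * (n * n).

(** Counters are stored by nesting depth, so that entering a loop moves none of them, whereas [env]
    is indexed from the innermost loop; hence [size env - x.+1]. [rep_cnt] also covers counters of
    loops that are not running, since the bit bound concerns every cell. *)
Record represents (env : seq nat) (s : state) (m : memory) : Prop := {
  rep_n : s 0 0 = n;
  rep_env : all (fun i => i < n) env;
  rep_in : forall i, i < S -> m i = s 0 i;
  rep_arr : forall k i, 0 < k < K -> m (S + (i * K + k)) = s k i;
  rep_var : forall x, x < size env ->
    m (S + ((size env - x.+1) * K + 0)) = nth 0 env x;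
  rep_cnt : forall x, m (S + (x * K + 0)) <= n
}.


Lemma addr_eq i k i' k' : k < K -> k' < K ->
  (S + (i * K + k) == S + (i' * K + k')) = (i == i') && (k == k').
Proof.
move=> kK kK'; rewrite eqn_add2l; apply/eqP/andP => [h|[/eqP-> /eqP->]] //.
have K0 : 0 < K by apply: leq_ltn_trans kK.
have hd : i = i'.
  by have := congr1 (divn^~ K) h; rewrite /= !divnMDl // !divn_small // !addn0.
by move: h; rewrite hd => /addnI ->.
Qed.

Lemma represents_set env s m k i v : represents env s m -> 0 < k < K ->
  represents env (upd s k i v) (update m (S + (i * K + k)) v).
Proof.
move=> [rn re ri ra rv rc] /andP[k0 kK]; split=> //.
- by rewrite /upd (ltn_eqF k0).
- move=> j jS; rewrite /update /upd (ltn_eqF k0).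
  by case: eqP => [jE|_]; [move: jS; rewrite jE; lia | exact: ri].
- move=> k' j /andP[k'0 k'K]; rewrite /update addr_eq // /upd andbC.
  case: (k' =P k) => [->|_] /=; last by rewrite ra // k'0.
  by rewrite /update; case: (j == i); rewrite // ra // k0.
- move=> x xe; rewrite /update addr_eq //; last by lia.
  by rewrite (ltn_eqF k0) andbF rv.
- move=> x; rewrite /update addr_eq //; last by lia.
  by rewrite (ltn_eqF k0) andbF rc.
Qed.

Lemma represents_out env s m i v : represents env s m -> 0 < i < S ->
  represents env (upd s 0 i v) (update m i v).
Proof.
move=> [rn re ri ra rv rc] /andP[i0 iS]; split=> //.
- by rewrite /upd eqxx /update; case: eqP i0 => // <-.
- by move=> j jS; rewrite /upd eqxx /update; case: eqP => // _; exact: ri.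
- move=> k j /andP[k0 kK]; rewrite /update /upd (gtn_eqF k0).
  by rewrite ifN ?ra ?k0 //; apply/eqP => jE; rewrite -jE ltnNge leq_addr in iS.
- move=> x xe; rewrite /update ifN ?rv //.
  by apply/eqP => jE; rewrite -jE ltnNge leq_addr in iS.
- move=> x; rewrite /update ifN ?rc //.
  by apply/eqP => jE; rewrite -jE ltnNge leq_addr in iS.
Qed.

Lemma represents_cnt env s m v : 0 < K -> represents env s m -> v <= n ->
  represents env s (update m (S + (size env * K + 0)) v).
Proof.
move=> K0 [rn re ri ra rv rc] vn; split=> //.
- by move=> j jS; rewrite /update; case: eqP => [jE|_]; [lia | rewrite ri].
- move=> k j /andP[k0 kK]; rewrite /update addr_eq // (gtn_eqF k0) andbF.
  by rewrite ra // k0.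
- move=> x xe; rewrite /update addr_eq // eqxx andbT.
  by case: eqP => [jE|_]; [lia | rewrite rv].
- by move=> x; rewrite /update; case: eqP.
Qed.

Lemma represents_cons env s m : represents env s m ->
  m (S + (size env * K + 0)) < n ->
  represents (m (S + (size env * K + 0)) :: env) s m.
Proof.
move=> [rn re ri ra rv rc] lt; split=> //=; first by rewrite lt.
case=> [_|x] /=; first by rewrite subn1.
by rewrite ltnS subSS => /rv.
Qed.

Lemma represents_behead i env s m : represents (i :: env) s m ->
  represents env s m /\ m (S + (size env * K + 0)) = i.
Proof.
move=> [rn /= /andP[_ re] ri ra rv rc]; split; last by have := rv 0 isT; rewrite /= subn1.
by split=> // x xe; have := rv x.+1; rewrite /= ltnS subSS => ->.
Qed.

Lemma eval_comp_exp env s m e : hexp_ok e -> represents env s m ->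
  eval m (comp_exp (size env) e) = ev n env s e.
Proof.
move=> ok rep; have [rn re ri ra rv rc] := rep.
have m0 : m 0 = n by rewrite ri.
elim: e ok => //=.
- move=> x _; case: ltnP => xe; last by rewrite nth_default.
  by rewrite -(rv _ xe) /= m0.
- by move=> a IH ok; rewrite m0 IH // -minnE ri // /S; lia.
- by move=> k a IH /andP[kK ok]; rewrite m0 IH // ra.
- by move=> e1 IH1 e2 IH2 /andP[ok1 ok2]; rewrite IH1 // IH2.
- by move=> e1 IH1 e2 IH2 /andP[ok1 ok2]; rewrite IH1 // IH2.
- by move=> e1 IH1 e2 IH2 /andP[ok1 ok2]; rewrite IH1 // IH2.
- move=> e1 IH1 e2 IH2 /andP[ok1 ok2].
  by rewrite m0 IH1 // IH2 // -minnE ri // /S; lia.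
Qed.

(** An increment of the bit length in units of [N], unlike the factor [expr_width]: a factor would
    compound to an exponential over the iterations of a loop, whereas increments only add up. *)
Fixpoint hexp_growth (e : hexp) : nat :=
  match e with
  | HConst v => v
  | HVar _ | HIn _ | HArr _ _ => 0
  | HAdd e1 e2 => (hexp_growth e1 + hexp_growth e2).+1
  | HSub e1 _ | HDiv e1 _ => hexp_growth e1
  | HMulIn e1 _ => (hexp_growth e1).+1
  end.

Section Bounds.
Variable N : nat.
Hypotheses (N_gt0 : 0 < N) (nN : n <= N).

(** Array 0 keeps the exponent [N] while [b] grows: it provides the right factors of products, which
    may lengthen a number by at most [N] bits. *)
Record bounded (b : nat) (s : state) : Prop := {
  bnd_in : forall i, s 0 i < 2 ^ N;
  bnd_arr : forall k i, 0 < k -> s k i < 2 ^ b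
}.

Lemma bounded_leq b b' s : b <= b' -> bounded b s -> bounded b' s.
Proof.
move=> bb [h1 h2]; split=> // k i k0.
by apply: leq_trans (h2 k i k0) _; rewrite leq_exp2l.
Qed.

Lemma n_lt : n < 2 ^ N.
Proof. by apply: (leq_trans (ltn_expl n (isT : 1 < 2))); rewrite leq_exp2l. Qed.

Lemma bounded_all b s k i : N <= b -> bounded b s -> s k i < 2 ^ b.
Proof.
move=> Nb [h1 h2]; case: k => [|k]; last exact: h2.
by apply: leq_trans (h1 i) _; rewrite leq_exp2l.
Qed.

Lemma represents_bounded env s m b : 0 < K -> N <= b -> represents env s m ->
  bounded b s -> forall a, m a < 2 ^ b.
Proof.
move=> K0 Nb [rn re ri ra rv rc] bd a.
case: (ltnP a S) => aS; first by rewrite ri // bounded_all.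
rewrite -(subnKC aS) (divn_eq (a - S) K).
(* Beyond the input area, remainder 0 means a loop counter, at most [n]; any other remainder means
   an array entry. *)
case: (posnP ((a - S) %% K)) => [->|k0].
  apply: leq_ltn_trans (rc _) (leq_trans n_lt _).
  by rewrite leq_exp2l.
by rewrite ra ?k0 ?ltn_mod // bounded_all.
Qed.

Lemma ev_lt env s b e : N <= b -> all (fun i => i < n) env -> bounded b s ->
  ev n env s e < 2 ^ (b + N * hexp_growth e).
Proof.
move=> Nb re bd.
have weak x c c' : x < 2 ^ c -> c <= c' -> x < 2 ^ c'.
  by move=> xc cc; apply: leq_trans xc _; rewrite leq_exp2l.
elim: e => /=.
- move=> v; apply: weak (ltn_expl v (isT : 1 < 2)) _; nia.
- move=> x; rewrite muln0 addn0; apply: weak Nb.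
  case: (ltnP x (size env)) => xe; last by rewrite nth_default // expn_gt0.
  by apply: ltn_trans (all_nthP 0 re x xe) n_lt.
- by move=> a _; rewrite muln0 addn0 bounded_all.
- by move=> k a _; rewrite muln0 addn0 bounded_all.
- move=> e1 h1 e2 h2.
  have x1 := weak _ _ (b + N * (hexp_growth e1 + hexp_growth e2)) h1.
  have x2 := weak _ _ (b + N * (hexp_growth e1 + hexp_growth e2)) h2.
  apply: (@weak _ (b + N * (hexp_growth e1 + hexp_growth e2)).+1); last by nia.
  by rewrite expnS mul2n -addnn -addnS leq_add //; [apply: ltnW; apply: x1|apply: x2]; nia.
- by move=> e1 h1 e2 _; apply: leq_ltn_trans (leq_subr _ _) h1.
- by move=> e1 h1 e2 _; apply: leq_ltn_trans (leq_div _ _) h1.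
- move=> e1 h1 e2 _; rewrite mulnS [N + _]addnC addnA expnD.
  by apply: ltn_mul h1 _; case: bd.
Qed.

Lemma bounded_set env s b k a e : N <= b -> all (fun i => i < n) env -> 0 < k ->
  bounded b s -> bounded (b + N * hexp_growth e) (run n env (CSet k a e) s).
Proof.
move=> Nb re k0 bd; have e_lt := ev_lt e Nb re bd.
have [h1 h2] := bounded_leq (leq_addr (N * hexp_growth e) b) bd.
split=> /= [i|k' i k'0]; rewrite /upd /update.
  by rewrite (ltn_eqF k0).
by case: eqP => _; [case: eqP => // _|]; exact: h2.
Qed.

Lemma bounded_out env s b a e :
  bounded b s -> bounded b (run n env (COut a e) s).
Proof.
move=> [h1 h2]; split=> /= [i|k' i k'0]; rewrite /upd /update.
  by rewrite eqxx; case: eqP => // _; apply: leq_ltn_trans (leq_subr _ _) _;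
     rewrite -{1}(expn0 2) ltn_exp2l.
by rewrite (gtn_eqF k'0) h2.
Qed.

(** Both branches of a conditional are counted, so that the bound depends on the program and [N]
    only. Nested loops contribute powers of [N], hence a polynomial for a fixed program. *)
Fixpoint growth (c : cmd) : nat :=
  match c with
  | CSkip | COut _ _ => 0
  | CSet _ _ e => hexp_growth e
  | CSeq c1 c2 | CIf _ c1 c2 => growth c1 + growth c2
  | CFor c => N * growth c
  end.

Definition store_cost a e :=
  expr_cost a + expr_cost e + expr_width a + expr_width e.

(** Cost in units of the final bit bound. The factor [N + 1] of a loop includes its last, failing
    test. *)
Fixpoint steps (d : nat) (c : cmd) : nat :=
  match c with
  | CSkip => 1
  | CSet k a e => store_cost (array_addr k (comp_exp d a)) (comp_exp d e)
  | COut a e =>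
      store_cost (out_addr (comp_exp d a)) (bool_expr (comp_exp d e))
  | CSeq c1 c2 => steps d c1 + steps d c2
  | CIf e c1 c2 =>
      expr_cost (comp_exp d e) + expr_width (comp_exp d e)
      + (steps d c1 + steps d c2)
  | CFor c =>
      store_cost (counter_addr d) (Const 0)
      + (expr_cost (loop_test d) + expr_width (loop_test d)
         + (steps d.+1 c
            + store_cost (counter_addr d) (Bin Add (Cell (counter_addr d)) (Const 1))))
        * (N + 1)
  end.


Hypothesis K_gt0 : 0 < K.

Lemma exec_store a e m b : 0 < b -> (forall x, m x < 2 ^ b) ->
  exists2 t, exec (Store a e) m t (update m (eval m a) (eval m e))
           & t <= b * store_cost a e.
Proof.
move=> b0 mb; eexists; first exact: ExecStore.
rewrite /store_cost !mulnDr !leq_add // ?eval_cost_leq // ?bitlen_eval //.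
Qed.

Lemma eval_counter env s m : represents env s m ->
  eval m (counter_addr (size env)) = S + (size env * K + 0).
Proof. by case=> rn _ ri _ _ _; rewrite /= ri // rn. Qed.

Lemma eval_loop_test env s m : represents env s m ->
  eval m (loop_test (size env)) = n - m (S + (size env * K + 0)).
Proof.
move=> rep; have := eval_counter rep; rewrite /loop_test /= => ->.
by case: rep => rn _ ri _ _ _; rewrite ri // rn.
Qed.

(** The bound [b] on the current state grows along the run; [B] stays above it until the end, and
    every step is charged at [B], so that the costs of successive steps have a common unit. *)
Lemma comp_correct B c env s m b : cmd_ok c -> represents env s m ->
  bounded b s -> N <= b -> b + N * growth c <= B ->
  exists t m', [/\ exec (comp (size env) c) m t m',
    t <= B * steps (size env) c,
    represents env (run n env c s) m' &
    bounded (b + N * growth c) (run n env c s)].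
Proof.
have small env' s' m' b' g : represents env' s' m' -> bounded b' s' ->
    N <= b' -> b' + N * g <= B -> 0 < B /\ forall x, m' x < 2 ^ B.
  move=> rep bd Nb bB; have bB' : b' <= B by apply: leq_trans (leq_addr _ _) bB.
  have NB := leq_trans Nb bB'; split; first exact: leq_trans NB.
  by apply: (represents_bounded K_gt0 NB rep); apply: bounded_leq bd.
elim: c env s m b => [|k a e|a e|c1 IH1 c2 IH2|e c1 IH1 c2 IH2|c IH] env s m b.
- move=> _ rep bd Nb bB; exists 1, m; split=> //=; first exact: ExecSkip.
    by rewrite muln1; lia.
  by rewrite muln0 addn0.
- move=> /and3P[kK oka oke] rep bd Nb bB.
  have [B0 mb] := small _ _ _ _ _ rep bd Nb bB.
  have [t ex tB] := exec_store (array_addr k (comp_exp (size env) a)) (comp_exp (size env) e) B0 mb.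
  exists t; eexists; split; [exact: ex|exact: tB| |].
    have -> : eval m (array_addr k (comp_exp (size env) a)) = S + (ev n env s a * K + k).
      rewrite /= (eval_comp_exp oka rep).
      by case: rep => rn _ ri _ _ _; rewrite ri // rn.
    by rewrite (eval_comp_exp oke rep); apply: represents_set.
  by apply: bounded_set => //; case: rep => //; case/andP: kK.
- move=> /andP[oka oke] rep bd Nb bB.
  have [B0 mb] := small _ _ _ _ _ rep bd Nb bB.
  have [t ex tB] := exec_store (out_addr (comp_exp (size env) a))
    (bool_expr (comp_exp (size env) e)) B0 mb.
  exists t; eexists; split; [exact: ex|exact: tB| |].
    have -> : eval m (out_addr (comp_exp (size env) a)) = 1 + minn (ev n env s a) (2 * (n * n)).
      rewrite /= (eval_comp_exp oka rep) minnE.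
      by case: rep => rn _ ri _ _ _; rewrite ri // rn.
    rewrite /= (eval_comp_exp oke rep); apply: represents_out => //.
    by rewrite /S; lia.
  by rewrite muln0 addn0; apply: bounded_out.
- move=> /= /andP[ok1 ok2] rep bd Nb; rewrite !mulnDr addnA => bB.
  have [|t1 [m1 [ex1 tB1 rep1 bd1]]] := IH1 env s m b ok1 rep bd Nb.
    exact: leq_trans (leq_addr _ _) bB.
  have [|t2 [m2 [ex2 tB2 rep2 bd2]]] := IH2 env _ m1 _ ok2 rep1 bd1 _ bB.
    exact: leq_trans Nb (leq_addr _ _).
  exists (t1 + t2), m2; split=> //; first exact: ExecSeq ex1 ex2.
  by rewrite leq_add.
- move=> /= /and3P[oke ok1 ok2] rep bd Nb bB.
  have [B0 mb] := small _ _ _ _ _ rep bd Nb bB.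
  have eE := eval_comp_exp oke rep.
  have c0 := eval_cost_leq B0 mb (comp_exp (size env) e).
  have w0 := bitlen_eval B0 mb (comp_exp (size env) e).
  case: ifPn => ev0.
    have [|t1 [m1 [ex1 tB1 rep1 bd1]]] := IH1 env s m b ok1 rep bd Nb.
      by apply: leq_trans bB; rewrite leq_add2l leq_mul2l leq_addr orbT.
    exists (eval_cost m (comp_exp (size env) e)
            + bitlen (eval m (comp_exp (size env) e)) + t1), m1; split=> //.
    + by apply: (ExecIfTrue _ _ ex1); rewrite eE.
    + by rewrite !mulnDr !leq_add // (leq_trans tB1) // leq_addr.
    + by apply: bounded_leq bd1; rewrite leq_add2l leq_mul2l leq_addr orbT.
  have [|t2 [m2 [ex2 tB2 rep2 bd2]]] := IH2 env s m b ok2 rep bd Nb.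
    by apply: leq_trans bB; rewrite leq_add2l leq_mul2l leq_addl orbT.
  exists (eval_cost m (comp_exp (size env) e)
          + bitlen (eval m (comp_exp (size env) e)) + t2), m2; split=> //.
  + by apply: (ExecIfFalse _ _ ex2); rewrite eE; apply/eqP; move: ev0; rewrite negbK.
  + by rewrite !mulnDr !leq_add // (leq_trans tB2) // leq_addl.
  + by apply: bounded_leq bd2; rewrite leq_add2l leq_mul2l leq_addl orbT.
- move=> /= okc rep bd Nb bB.
  set d := size env; set f := fun i => run n (i :: env) c.
  have B0 : 0 < B by apply: leq_trans (leq_trans (leq_addr _ _) bB); apply: leq_trans Nb.
  have NB : N <= B by apply: leq_trans (leq_trans Nb (leq_addr _ _)) bB.
  set g := growth c in bB *.
  set u := expr_cost (loop_test d) + expr_width (loop_test d) + (steps d.+1 c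
     + store_cost (counter_addr d) (Bin Add (Cell (counter_addr d)) (Const 1))).
  have gB j : j <= n -> b + N * (j * g) <= B.
    move=> jn; apply: leq_trans bB; rewrite leq_add2l leq_mul2l leq_mul ?orbT //.
    exact: leq_trans nN.
  (* Induction on the number [j] of iterations left after [i] are done; the [j.+1] accounts for the
     failing test. *)
  have loop j : forall i m', i + j = n -> represents env (iteri i f s) m' ->
    m' (S + (d * K + 0)) = i -> bounded (b + N * (i * g)) (iteri i f s) ->
    exists t m'', [/\ exec (While (loop_test d) (Seq (comp d.+1 c) (loop_incr d))) m' t m'',
      t <= B * (u * j.+1), represents env (iteri n f s) m'' &
      bounded (b + N * (n * g)) (iteri n f s)].
    elim: j => [|j IHj] i m' ijn rep' cnt bd'.
      rewrite addn0 in ijn; rewrite ijn in rep' cnt bd'.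
      have mb : forall x, m' x < 2 ^ B.
        by apply: (represents_bounded K_gt0 NB rep'); apply: bounded_leq bd'; exact: gB.
      exists (eval_cost m' (loop_test d) + bitlen (eval m' (loop_test d))), m'; split=> //.
        apply: ExecWhileFalse.
        by rewrite (eval_loop_test rep') cnt subnn.
      have := eval_cost_leq B0 mb (loop_test d).
      have := bitlen_eval B0 mb (loop_test d).
      rewrite muln1 /u; move: (expr_cost _) (expr_width _) => x y yB xB.
      rewrite !mulnDr; lia.
    have i_lt : i < n by rewrite -ijn; lia.
    have mb : forall x, m' x < 2 ^ B.
      by apply: (represents_bounded K_gt0 NB rep'); apply: bounded_leq bd'; apply: gB; apply: ltnW.
    have repc := represents_cons rep'; rewrite -/d cnt in repc.
    have [||t1 [m1 [ex1 tB1 rep1 bd1]]] := IH (i :: env) _ m' _ okc (repc i_lt) bd'.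
    + exact: leq_trans Nb (leq_addr _ _).
    + by rewrite -addnA -mulnDr -/g addnC; have := gB i.+1 i_lt; rewrite mulSn [g + _]addnC addnC.
    have bd1' : bounded (b + N * (i.+1 * g)) (iteri i.+1 f s).
      by apply: bounded_leq bd1; rewrite -addnA -mulnDr mulSn [g + _]addnC.
    have mb1 : forall x, m1 x < 2 ^ B.
      by apply: (represents_bounded K_gt0 NB rep1); apply: bounded_leq bd1'; apply: gB.
    have [rep1' cnt1] := represents_behead rep1.
    have [t2 ex2 tB2] := exec_store (counter_addr d)
      (Bin Add (Cell (counter_addr d)) (Const 1)) B0 mb1.
    have incE : eval m1 (Bin Add (Cell (counter_addr d)) (Const 1)) = i.+1.
      have -> : eval m1 (Bin Add (Cell (counter_addr d)) (Const 1))
                = m1 (eval m1 (counter_addr d)) + 1 by [].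
      by rewrite (eval_counter rep1') cnt1 addn1.
    rewrite (eval_counter rep1') incE in ex2.
    have [||||t3 [m3 [ex3 tB3 rep3 bd3]]] := IHj i.+1 (update m1 (S + (d * K + 0)) i.+1).
    + by rewrite -ijn addnS.
    + by apply: represents_cnt => //; apply: i_lt.
    + by rewrite /update eqxx.
    + exact: bd1'.
    exists (eval_cost m' (loop_test d) + bitlen (eval m' (loop_test d)) + (t1 + t2) + t3), m3.
    split=> //.
      apply: (ExecWhileTrue _ (ExecSeq ex1 ex2) ex3).
      by rewrite (eval_loop_test rep') cnt subn_eq0 -ltnNge.
    have cB := eval_cost_leq B0 mb (loop_test d).
    have wB := bitlen_eval B0 mb (loop_test d).
    rewrite [u * _]mulnS mulnDr leq_add // /u; move: tB1 tB2 cB wB.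
    rewrite [size (i :: env)]/= -/d.
    move: (steps _ _) (store_cost _ _) (expr_cost _) (expr_width _) => x1 x2 x y.
    rewrite !mulnDr; lia.
  have mb : forall x, m x < 2 ^ B.
    apply: (represents_bounded K_gt0 NB rep).
    by apply: bounded_leq bd; apply: leq_trans (leq_addr _ _) bB.
  have [t1 ex1 tB1] := exec_store (counter_addr d) (Const 0) B0 mb.
  rewrite (eval_counter rep) [eval m (Const 0)]/= in ex1.
  have [||||t2 [m2 [ex2 tB2 rep2 bd2]]] := loop n 0 (update m (S + (d * K + 0)) 0).
  + by [].
  + exact: represents_cnt.
  + by rewrite /update eqxx.
  + by rewrite mul0n muln0 addn0.
  exists (t1 + t2), m2; split=> //; first exact: ExecSeq ex1 ex2.
    rewrite mulnDr leq_add //; apply: leq_trans tB2 _.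
    by rewrite leq_mul2l leq_mul2l addn1 ltnS nN !orbT.
  by apply: bounded_leq bd2; rewrite leq_add2l leq_mul2l leq_mul ?orbT.
Qed.

End Bounds.
End Compile.

(** * Polynomial bounds and the criterion for polynomial time *)

Definition poly_bounded (f : nat -> nat) : Prop :=
  exists p : {poly nat}, forall x, f x <= p.[x]%R.

Lemma poly_bounded_const a : poly_bounded (fun => a).
Proof. by exists (a%:P)%R => x; rewrite hornerC. Qed.

Lemma poly_bounded_id : poly_bounded id.
Proof. by exists 'X%R => x; rewrite hornerX. Qed.

Lemma poly_bounded_add f g : poly_bounded f -> poly_bounded g ->
  poly_bounded (fun x => f x + g x).
Proof.
by move=> [p fp] [q gq]; exists (p + q)%R => x; rewrite hornerD leq_add.
Qed.

Lemma poly_bounded_mul f g : poly_bounded f -> poly_bounded g ->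
  poly_bounded (fun x => f x * g x).
Proof.
by move=> [p fp] [q gq]; exists (p * q)%R => x; rewrite hornerM leq_mul.
Qed.

Lemma poly_bounded_growth c : poly_bounded (growth^~ c).
Proof.
elim: c => /= [|k a e|a e|c1 h1 c2 h2|e c1 h1 c2 h2|c h];
  do ?[exact: poly_bounded_const | exact: poly_bounded_add].
exact: poly_bounded_mul poly_bounded_id _.
Qed.

Lemma poly_bounded_steps K d c : poly_bounded (fun N => steps K N d c).
Proof.
elim: c d => /= [|k a e|a e|c1 h1 c2 h2|e c1 h1 c2 h2|c h] d;
  do ?[exact: poly_bounded_const | exact: poly_bounded_add].
- by do !apply: poly_bounded_add; do ?exact: poly_bounded_const.
- apply: poly_bounded_add; first exact: poly_bounded_const.
  apply: poly_bounded_mul.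
    by do !apply: poly_bounded_add; do ?exact: poly_bounded_const.
  exact: poly_bounded_add poly_bounded_id (poly_bounded_const _).
Qed.

Definition initial_state (w : seq nat) : state :=
  fun k => if k == 0 then nth 0 w else fun => 0.

(** Every address is computed from [n] in cell 0, which is also the first output cell; hence the
    flag is moved there only at the very end. *)
Definition ram_program K flag c :=
  Seq (comp K 0 c) (Store (Const 0) (bool_expr (Cell (array_addr K flag (Const 0))))).

Lemma bitlen_gt0 v : 0 < bitlen v.
Proof. by []. Qed.

Lemma size_bit_size w : size w <= bit_size w.
Proof.
rewrite /bit_size -sum1_size; apply: leq_sum => v _; exact: bitlen_gt0.
Qed.

Lemma nth_lt_bit_size w i : nth 0 w i < 2 ^ bit_size w.
Proof.
case: (ltnP i (size w)) => iw; last by rewrite nth_default // expn_gt0.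
apply: leq_trans (ltn_pow2_bitlen _) _; rewrite leq_exp2l //.
by rewrite /bit_size (big_nth 0) big_mkord (bigD1 (Ordinal iw)) //= leq_addr.
Qed.

(** The prescribed length of the input word makes it end exactly where the free memory begins, so
    all arrays and counters start at 0. The answer has to fit into the input area, the range of
    [COut]. *)
Theorem poly_time_by_cmd (I : Type) (encode : I -> seq nat)
    (answer : I -> seq nat -> Prop) (c : cmd) (K flag : nat) :
  cmd_ok K c -> 0 < flag < K ->
  (forall x, exists n, [/\ size (encode x) = 2 + 2 * (n * n),
     nth 0 (encode x) 0 = n &
     let s := run n [::] c (initial_state (encode x)) in
     exists w, [/\ answer x w, size w <= 2 + 2 * (n * n) &
       forall i, i < size w ->
         nth 0 w i = if i == 0 then nat_of_bool (s flag 0 != 0) else s 0 i]]) ->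
  poly_time_solvable encode answer.
Proof.
move=> okc flagK H; set q := ram_program K flag c.
have K0 : 0 < K by case/andP: flagK => _; apply: leq_ltn_trans.
set a := Const 0; set e := bool_expr (Cell (array_addr K flag (Const 0))).
have [p pP] : poly_bounded (fun N => (N + N * growth N c) * (steps K N 0 c + store_cost a e)).
  apply: poly_bounded_mul; apply: poly_bounded_add.
  - exact: poly_bounded_id.
  - by apply: poly_bounded_mul; [exact: poly_bounded_id | exact: poly_bounded_growth].
  - exact: poly_bounded_steps.
  - exact: poly_bounded_const.
exists q, p => x; have [n [size_n n_eq [w [ans size_w wP]]]] := H x.
set s := run n [::] c _ in wP; set N := bit_size (encode x).
(* Each cell has bit length at least 1, so the bit size bounds the number of cells and thereby the
   number [n] of iterations. *)
have sizeN : 2 + 2 * (n * n) <= N by rewrite -size_n size_bit_size.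
have N0 : 0 < N by lia.
have nN : n <= N by nia.
have rep : represents K n [::] (initial_state (encode x)) (load (encode x)).
  split=> //.
  - move=> k i /andP[k0 kK]; rewrite /initial_state (gtn_eqF k0) /load.
    by rewrite nth_default // size_n leq_addr.
  - by move=> y; rewrite /load nth_default // size_n leq_addr.
have bd : bounded N N (initial_state (encode x)).
  split=> [i|k i k0]; first exact: nth_lt_bit_size.
  by rewrite /initial_state (gtn_eqF k0) expn_gt0.
have [t [m [ex tB rep' bd']]] :=
  comp_correct N0 nN K0 okc rep bd (leqnn N) (leqnn _).
have B0 : 0 < N + N * growth N c by rewrite addn_gt0 N0.
have [t' ex' tB'] := exec_store a e B0
  (represents_bounded nN K0 (leq_addr _ _) rep' bd').
have eE : eval m e = (s flag 0 != 0).
  have -> : eval m e = 1 - (1 - m (2 + 2 * (m 0 * m 0) + (0 * K + flag))) by [].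
  case: rep' => rn _ ri ra _ _; rewrite [m 0]ri // rn ra //.
  by rewrite -/s; case: (s flag 0) => [|j] //; rewrite subSS sub0n.
exists (t + t'), (update m (eval m a) (eval m e)), w; split=> //.
- exact: ExecSeq ex ex'.
- by apply: leq_trans (pP N); rewrite mulnDr leq_add.
- move=> i iw; rewrite wP // /update eE /=; case: eqP => // _.
  by case: rep' => _ _ ri _ _ _; rewrite ri //; apply: leq_trans size_w.
Qed.

(** * Growing trees and central edges *)

Section Graph.
Variables (n : nat) (G : wgraph n) (X : 'I_n -> 'I_n -> nat).
Hypothesis X_sym : forall x y, edge G x y -> X x y = X y x.

Definition int_length x p := \sum_(a <- pairmap X x p) a.

Lemma int_length_cons x y p : int_length x (y :: p) = X x y + int_length y p.
Proof. by rewrite /int_length /= big_cons. Qed.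

Lemma int_length_cat x p q :
  int_length x (p ++ q) = int_length x p + int_length (last x p) q.
Proof. by rewrite /int_length pairmap_cat big_cat. Qed.

Lemma int_length_rcons x p y :
  int_length x (rcons p y) = int_length x p + X (last x p) y.
Proof. by rewrite -cats1 int_length_cat int_length_cons /int_length big_nil addn0. Qed.

(** The bound may depend on the two ends of the path: the induction over leaves needs the sum of
    their labels, and a constant bound appears only afterwards. *)
Definition tree_within (F : 'I_n -> 'I_n -> nat) (T : subgraph n) : Prop :=
  [/\ is_subgraph G T, is_tree T &
    forall x y p, x \in nodes T -> y \in nodes T -> path_between T x y p ->
      int_length x p <= F x y].

Definition point_tree u : subgraph n := Subgraph [set u] (fun _ _ => false).

Definition add_leaf (T : subgraph n) y z : subgraph n :=
  Subgraph (z |: nodes T)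
    (fun a b => [|| links T a b, (a == y) && (b == z) | (a == z) && (b == y)]).

Lemma point_tree_within F u : tree_within F (point_tree u).
Proof.
split.
- by split=> // x y.
- split; first split.
  + by apply/set0Pn; exists u; rewrite inE.
  + by move=> x y; rewrite !inE => /eqP-> /eqP->; apply: connect0.
  + by case=> [|a [|b c]] // _ /andP[].
- move=> x y p; rewrite !inE => /eqP-> /eqP-> [].
  by case: p => [|a p] //= _ _ _; rewrite /int_length big_nil.
Qed.

(** The new node has [y] as its only neighbor, so it lies on no cycle and a simple path meets it
    only at an end; such a path is one of [T] at [y] extended by the new edge. [F] is not assumed
    symmetric, whence two inequalities for [z]. *)
Lemma add_leaf_within F F' T y z :
  tree_within F T -> y \in nodes T -> z \notin nodes T -> edge G y z ->
  {in nodes T &, forall a b, F a b <= F' a b} ->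
  {in nodes T, forall a, F a y + X y z <= F' a z /\ F y a + X y z <= F' z a} ->
  tree_within F' (add_leaf T y z).
Proof.
move=> [[sT subT] [[T0 cT] aT] FT] yT zT yz FF FFz.
have yNz : y != z by apply: contraNneq zT => <-.
have lsym a b : links (add_leaf T y z) a b = links (add_leaf T y z) b a.
  by rewrite /= sT [X in _ || X]orbC andbC [(a == y) && _]andbC.
have lz a b : links T a b -> (a != z) && (b != z).
  move=> /subT /and3P[_ aN bN].
  by rewrite (contraNneq _ zT) ?(contraNneq _ zT) // => <-.
have nbr b : links (add_leaf T y z) z b -> b = y.
  rewrite /= eqxx (eq_sym z) (negPf yNz) /= => /orP[/lz|/eqP //].
  by rewrite eqxx.
have old a b : a != z -> b != z -> links (add_leaf T y z) a b = links T a b.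
  by move=> az bz; rewrite /= (negPf az) (negPf bz) andbF !orbF.
have old_path a p : z \notin a :: p ->
    path (links (add_leaf T y z)) a p = path (links T) a p.
  elim: p a => //= b p IH a; rewrite !inE !negb_or => /and3P[az bz pz].
  have -> : path (links (add_leaf T y z)) b p = path (links T) b p.
    by apply: IH; rewrite inE negb_or bz.
  by congr andb; apply: old; rewrite eq_sym.
have leaf_path p b : z \notin p -> z \notin [:: b] ->
    path_between (add_leaf T y z) z b p ->
    exists2 q, p = y :: q & path_between T y b q.
  move=> zp zb [pp pl pu]; case: p zp pp pl pu => [|a q].
    by move=> _ _ /= zEb; rewrite zEb inE eqxx in zb.
  move=> zq /= /andP[/nbr ay qq] ql /and3P[_ aq uq]; subst a.
  by exists q => //; split=> //; [rewrite -old_path | rewrite /= aq].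
have rev_path a b p : path (links (add_leaf T y z)) a p -> last a p = b ->
    path (links (add_leaf T y z)) b (rev (belast a p)).
  move=> pp <-; rewrite rev_path.
  by rewrite (eq_path (e' := links (add_leaf T y z))) // => c d; rewrite lsym.
split.
- split=> [a b|a b /or3P[/subT /and3P[-> aN bN]|/andP[/eqP-> /eqP->]|/andP[/eqP-> /eqP->]]].
  + exact: lsym.
  + by rewrite !inE aN bN !orbT.
  + by rewrite yz !inE yT eqxx orbT.
  + by rewrite edge_sym yz !inE yT eqxx orbT.
- have sym : connect_sym (links (add_leaf T y z)).
    by apply: sym_connect_sym; move=> a b; rewrite lsym.
  have toy a : a \in nodes (add_leaf T y z) -> connect (links (add_leaf T y z)) y a.
    rewrite !inE => /orP[/eqP->|aT'].
      by apply: connect1; rewrite /= !eqxx orbT.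
    apply: (connect_sub _ (cT y a yT aT')) => c d cd.
    by apply: connect1; rewrite /= cd.
  split; first split.
  + by apply/set0Pn; exists z; rewrite !inE eqxx.
  + by move=> a b /toy ya /toy yb; apply: connect_trans yb; rewrite sym.
  + move=> c sc /andP[cc uc]; case: (boolP (z \in c)) => zc; last first.
      apply: (aT c sc); rewrite /ucycle uc andbT.
      case: c zc cc {sc uc} => //= a p zc.
      by rewrite old_path // -rcons_cons mem_rcons inE negb_or zc andbT;
         move: zc; rewrite inE negb_or => /andP[].
    (* Rotated to start at [z], the cycle has a second and a last node that are both neighbors of
       [z], hence both [y], against uniqueness. *)
    have [i p Ep] := rot_to zc.
    have : cycle (links (add_leaf T y z)) (z :: p) by rewrite -Ep rot_cycle.
    have : uniq (z :: p) by rewrite -Ep rot_uniq.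
    have : 1 < size p by have := size_rot i c; rewrite Ep => /= sE; move: sc; rewrite -sE.
    case: p {Ep} => // a p; case/lastP: p => // p b _ apu.
    have cE (e : rel 'I_n) : cycle e (z :: a :: rcons p b) =
        [&& e z a, path e a (rcons p b) & e b z].
      by rewrite /= rcons_path last_rcons.
    rewrite cE => /and3P[/nbr ay _]; rewrite lsym => /nbr bE.
    by move: apu; rewrite ay bE /= mem_rcons inE eqxx andbF.
- move=> a b p aN bN pab; have [pp pl pu] := pab.
  case: (boolP (z \in a :: p)) => zp; last first.
    have za : a != z by apply: contraNneq zp => ->; rewrite inE eqxx.
    have zb : b != z by apply: contraNneq zp => <-; rewrite -pl mem_last.
    have aT' : a \in nodes T by move: aN; rewrite !inE (negPf za).
    have bT' : b \in nodes T by move: bN; rewrite !inE (negPf zb).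
    apply: leq_trans (FF a b aT' bT'); apply: FT => //.
    by split=> //; rewrite -old_path.
  move: zp; rewrite inE => /orP[/eqP zE|zp].
    subst a; case: (eqVneq b z) => [bz|bz].
      case: p pab pp pl pu => [|c p] _ _ pl pu; first by rewrite /int_length big_nil.
      have := mem_last c p; rewrite [last c p]pl bz.
      by move: pu; rewrite cons_uniq => /andP[/negPf-> _].
    have bT' : b \in nodes T by move: bN; rewrite !inE (negPf bz).
    have [||q -> pq] := leaf_path p b _ _ pab.
    + by case/andP: pu.
    + by rewrite inE eq_sym.
    rewrite int_length_cons addnC -(X_sym yz) -[X in _ <= X]addn0.
    have [_ h] := FFz b bT'; rewrite addn0; apply: leq_trans h.
    by rewrite leq_add2r; apply: FT.
  case/splitPr: p / zp pab pp pl pu => p1 p2 pab pp pl pu.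
  have za : a != z by apply: contraTneq pu => ->; rewrite /= mem_cat inE eqxx orbT.
  have aT' : a \in nodes T by move: aN; rewrite !inE (negPf za).
  move: pp; rewrite cat_path => /= /and3P[pp1 lyz pp2].
  have l1 : last a p1 = y by apply: nbr; rewrite lsym.
  (* A node after [z] would again be [y], which was visited just before [z]. *)
  have p20 : p2 = [::].
    case: p2 pp2 pu {pab pl} => // c p2 /andP[/nbr cy _].
    rewrite -cat_cons cat_uniq => /and3P[_ /hasPn/(_ y) h _].
    by have := mem_last a p1; rewrite l1 (negPf (h _)) // cy !inE eqxx orbT.
  subst p2; move: pl; rewrite last_cat /= => zb; subst b.
  rewrite int_length_cat int_length_cons l1 /int_length big_nil addn0.
  have [h _] := FFz a aT'; apply: leq_trans h; rewrite leq_add2r.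
  apply: FT => //; split=> //.
    rewrite -old_path //; apply: contraTN pu => zp1.
    by rewrite -cat_cons cat_uniq /= zp1 andbF.
  by move: pu; rewrite -cat_cons cat_uniq => /andP[].
Qed.


(** * The central edge of a tree *)

Lemma int_length_rev x p : path (edge G) x p ->
  int_length (last x p) (rev (belast x p)) = int_length x p.
Proof.
elim: p x => [|y p IH] x /=; first by rewrite /int_length !big_nil.
case/andP=> xy yp; rewrite rev_cons int_length_rcons int_length_cons IH //.
have -> : last (last y p) (rev (belast y p)) = y.
  by case: p {IH yp} => //= z p; rewrite rev_cons last_rcons.
by rewrite addnC X_sym // edge_sym.
Qed.

(** [a] is the length already behind, and [v] is the first node of [p] with at most half of [d]
    ahead. As long as more than half is ahead, less than half is behind, which keeps the hypothesis
    on [a]. *)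
Lemma halve_path d a x p : p != [::] -> a + int_length x p = d -> 2 * a <= d ->
  exists p1 v p2, [/\ p = p1 ++ v :: p2, 2 * (a + int_length x p1) <= d &
                      2 * int_length v p2 <= d].
Proof.
elim: p a x => // v p IH a x _; rewrite int_length_cons => ad a2.
case: (leqP (2 * int_length v p) d) => vd.
  by exists [::], v, p; rewrite /int_length big_nil addn0.
have p0 : p != [::] by case: (p) vd => //; rewrite /int_length big_nil.
have [||p1 [w [p2 [-> h1 h2]]]] := IH (a + X x v) v p0; try lia.
by exists (v :: p1), w, p2; rewrite int_length_cons addnA.
Qed.

Lemma simple_path_of_connect (e : rel 'I_n) x y : connect e x y ->
  exists p, [/\ path e x p, last x p = y & uniq (x :: p)].
Proof.
by case/connectP=> p ep ->; case: (shortenP ep) => q eq uq _; exists q.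
Qed.

Lemma path_connect_mem (e : rel 'I_n) x p y : path e x p -> y \in x :: p ->
  connect e x y.
Proof. by move=> ep; apply: path_connect. Qed.

Lemma center_edge T d : is_subgraph G T -> is_tree T -> 1 < #|nodes T| ->
  (exists x y p, [/\ x \in nodes T, y \in nodes T, path_between T x y p &
                     int_length x p = d]) ->
  (forall x y p, x \in nodes T -> y \in nodes T -> path_between T x y p ->
     int_length x p <= d) ->
  exists u v (A B : {set 'I_n}) a b,
    [/\ [/\ edge G u v, a + b + X u v <= d, 2 * a <= d & 2 * b <= d],
      [/\ u \in A, v \in B & nodes T \subset A :|: B],
      (forall z, z \in A -> exists p,
         [/\ path (edge G) u p, last u p = z, uniq (u :: p), v \notin p &
             int_length u p <= a]) &
      (forall z, z \in B -> exists p,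
         [/\ path (edge G) v p, last v p = z, uniq (v :: p), u \notin p &
             int_length v p <= b])].
Proof.
move=> [sT subT] [[_ cT] aT] T1 dex dmax.
(* If an empty path attains the maximum then [d = 0], and a path between two distinct nodes attains
   it too; that one has an edge to cut. *)
have [x [y [p [xT yT [pp pl pu] pd p0]]]] : exists x y p,
    [/\ x \in nodes T, y \in nodes T, path_between T x y p, int_length x p = d &
        p != [::]].
  have [x [y [p [xT yT pxy pd]]]] := dex.
  case: p pxy pd => [|c p] pxy pd; last by exists x, y, (c :: p).
  have [a [b [aN bN ab]]] := card_gt1P T1.
  have [q [qq ql qu]] := simple_path_of_connect (cT a b aN bN).
  exists a, b, q; split=> //.
    apply/eqP; rewrite eqn_leq (dmax a b) //= -pd.
    by rewrite /int_length big_nil.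
  by apply: contraNneq ab => q0; rewrite -ql q0.
have [|p1 [v [p2 [pE h1 h2]]]] := @halve_path d 0 x p p0 pd; first by rewrite muln0.
rewrite add0n in h1; subst p; set u := last x p1.
have linkN s t : links T s t -> (s \in nodes T) && (t \in nodes T).
  by case/subT/and3P=> _ -> ->.
have linkE : subrel (links T) (edge G) by move=> s t /subT/and3P[].
move: (pp); rewrite cat_path /= -/u => /and3P[pp1 uv pp2].
(* The tree without the edge [uv]; its components of [u] and of [v] are the two sides. *)
pose e : rel 'I_n := fun s t =>
  links T s t && ~~ ((s == u) && (t == v) || (s == v) && (t == u)).
have eT : subrel e (links T) by move=> s t /andP[].
have eG : subrel e (edge G) by move=> s t /eT /linkE.
have esym : symmetric e.
  by move=> s t; rewrite /e sT orbC [(s == u) && _]andbC [(s == v) && _]andbC.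
have csym : connect_sym e by apply: sym_connect_sym.
(* A path from [u] to [v] in [e] would form a cycle with [uv]; it has at least two edges because [e]
   omits [uv]. *)
have bridge : ~~ connect e u v.
  apply/negP => /simple_path_of_connect [q [eq ql qu]].
  apply: (aT (u :: q)).
    case: q eq ql {qu} => [_ /= ql|c [|c' q]] //=.
      by have := edge_irr G u; rewrite {2}ql linkE.
    by rewrite andbT => ec cv; move: ec; rewrite cv /e !eqxx andbF.
  rewrite /ucycle qu andbT /= rcons_path (sub_path eT eq) ql.
  by rewrite sT.
have vp1 : v \notin x :: p1.
  move: pu; rewrite -cat_cons cat_uniq => /and3P[_ /hasPn/(_ v) h _].
  by apply: h; rewrite inE eqxx.
have up2 : u \notin v :: p2.
  move: pu; rewrite -cat_cons cat_uniq => /and3P[_ /hasPn h _].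
  by apply/negP => /h; rewrite mem_last.
have avoid w s q : path (links T) s q -> w \notin s :: q -> (w == u) || (w == v) ->
    path e s q.
  elim: q s => //= t q IH s /andP[st tq]; rewrite !inE !negb_or => /and3P[ws wt wq] wuv.
  rewrite IH ?inE ?negb_or ?wt // andbT /e st /=.
  by case/orP: wuv => /eqP wE; rewrite -wE [s == w]eq_sym [t == w]eq_sym
    (negPf ws) (negPf wt) ?andbF.
have ep1 : path e x p1 by apply: (avoid v); rewrite ?eqxx ?orbT.
have ep2 : path e v p2 by apply: (avoid u); rewrite ?eqxx.
have /andP[uT vT] := linkN _ _ uv.
have conn_nodes s t : connect e s t -> s \in nodes T -> t \in nodes T.
  case/connectP=> q eq -> {t}; elim: q s eq => //= t q IH s /andP[/eT/linkN/andP[_ tT] tq] _.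
  exact: IH.
have disj s q t r : path e s q -> path e t r -> connect e u s -> connect e v t ->
    ~~ has (mem (s :: q)) (t :: r).
  move=> sq tr us vt; apply/hasPn => w wt; apply: contra bridge => ws.
  apply: connect_trans us _; apply: connect_trans (path_connect_mem sq ws) _.
  rewrite csym; apply: connect_trans vt _; exact: path_connect_mem tr wt.
have xu : connect e u x by rewrite csym; apply/connectP; exists p1.
have pd' : int_length x p1 + X u v + int_length v p2 = d.
  by rewrite -pd int_length_cat int_length_cons addnA.
exists u, v, [set z | connect e u z], [set z | connect e v z],
  (int_length x p1), (int_length v p2); split.
- by split; [exact: linkE | rewrite -pd' addnAC | | ].
- split; rewrite ?inE ?connect0 //; apply/subsetP => z zT; rewrite !inE.
  have /connectP[q qq ->] := cT u z uT zT.
  elim/last_ind: q qq => [|q c IH]; first by rewrite connect0.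
  rewrite rcons_path last_rcons => /andP[/IH {}IH lc].
  case: (boolP (e (last u q) c)) => ec.
    by case/orP: IH => h; rewrite (connect_trans h (connect1 ec)) ?orbT.
  move: ec; rewrite /e lc /= negbK => /orP[/andP[_ /eqP->]|/andP[_ /eqP->]];
    by rewrite connect0 ?orbT.
- move=> z; rewrite inE => uz; have [q [eq ql qu]] := simple_path_of_connect uz.
  have vq : v \notin q.
    apply: contra bridge => vq; apply: (path_connect_mem eq).
    by rewrite inE vq orbT.
  exists q; split=> //; first exact: sub_path eG _ _ eq.
  have eq' : path e z (rev (belast u q)).
    rewrite -ql rev_path (eq_path (e' := e)) // => s t; exact: esym.
  have lq' : last z (rev (belast u q)) = u.
    by rewrite -ql; case: (q) => //= c r; rewrite rev_cons last_rcons.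
  (* From [z] back to [u], across [uv], then along the longest path to [y]: this is a simple path of
     [T], so its length is at most [d], and cancelling the common part bounds the distance from [u]
     to [z] by that from [u] to [x]. *)
  have := dmax z y (rev (belast u q) ++ v :: p2) (conn_nodes _ _ uz uT) yT.
  have lrev : int_length z (rev (belast u q)) = int_length u q.
    by rewrite -[z in LHS]ql int_length_rev //; exact: sub_path eG _ _ eq.
  rewrite int_length_cat int_length_cons lq' lrev.
  move=> H; suff : path_between T z y (rev (belast u q) ++ v :: p2).
    by move/H; rewrite -pd' addnA !leq_add2r.
  split.
  + rewrite cat_path lq' /= uv pp2 andbT andbT; exact: sub_path eT _ _ eq'.
  + by rewrite last_cat /=; move: pl; rewrite last_cat.
  + rewrite -cat_cons cat_uniq disj ?connect0 //.
    have -> : uniq (z :: rev (belast u q)).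
      by rewrite -ql -rev_rcons -lastI rev_uniq.
    by move: pu; rewrite -cat_cons cat_uniq => /and3P[].
- move=> z; rewrite inE => vz; have [q [eq ql qu]] := simple_path_of_connect vz.
  have uq : u \notin q.
    apply: contra bridge => uq; rewrite csym; apply: (path_connect_mem eq).
    by rewrite inE uq orbT.
  exists q; split=> //; first exact: sub_path eG _ _ eq.
  have := dmax x z (p1 ++ v :: q) xT (conn_nodes _ _ vz vT).
  rewrite int_length_cat int_length_cons -/u.
  move=> H; suff : path_between T x z (p1 ++ v :: q) by move/H; rewrite -pd' -!addnA !leq_add2l.
  split.
  + by rewrite cat_path /= -/u uv pp1 (sub_path eT eq).
  + by rewrite last_cat.
  + rewrite -cat_cons cat_uniq disj // ?connect0 // qu.
    by move: pu; rewrite -cat_cons cat_uniq => /and3P[->].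
Qed.

(** Labels of walks that start at an end and never enter an end again. The initial labels are not
    compared with [D]: an end whose label exceeds [D] is present, but no step can leave it. *)
Inductive reach u v p q D : 'I_n -> nat -> Prop :=
  | reach_left : reach u v p q D u p
  | reach_right : reach u v p q D v q
  | reach_step y z l : reach u v p q D y l -> edge G y z -> z != u -> z != v ->
      l + X y z <= D -> reach u v p q D z (l + X y z).

Lemma reach_swap u v p q D z l : reach u v p q D z l -> reach v u q p D z l.
Proof.
elim=> [||y w k _ IH yw wu wv kD]; [exact: reach_right | exact: reach_left|].
exact: reach_step.
Qed.

Lemma reach_path u v p q D r : path (edge G) u r -> uniq (u :: r) -> v \notin r ->
  p + int_length u r <= D -> reach u v p q D (last u r) (p + int_length u r).
Proof.
elim/last_ind: r => [|r z IH].
  by rewrite /int_length big_nil addn0 => *; exact: reach_left.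
rewrite rcons_path last_rcons int_length_rcons mem_rcons inE negb_or.
move=> /andP[ur lz] /= /andP[]; rewrite mem_rcons inE negb_or rcons_uniq.
move=> /andP[uz ur'] /andP[_ ur''] /andP[vz vr]; rewrite addnA => le.
apply: reach_step => //; rewrite 1?eq_sym //; apply: IH => //=.
  by rewrite ur'.
exact: leq_trans (leq_addr _ _) le.
Qed.

(** A label below [inf] can only come from [u], so raising the initial label of [u] merely
    translates it. This carries distances from one end over to the run with the final initial
    labels. *)
Lemma reach_shift u v p q D inf E z l : reach u v 0 inf E z l ->
  l < inf -> p + l <= D -> reach u v p q D z (p + l).
Proof.
elim=> [_ _||y w k _ IH yw wu wv kE kinf kD].
- by rewrite addn0; exact: reach_left.
- by rewrite ltnn.
- rewrite addnA; apply: reach_step => //; last by rewrite -addnA.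
  by apply: IH; lia.
Qed.

End Graph.

(** * Dijkstra's rule from an edge *)

(* Array numbers.  [aL]: common denominator; [aED], [aX]: adjacency matrix and
   integer weights, [2 * aL] times the given ones; [aINF]: more than the length
   of any simple path; [aU], [aV]: central edge, with the initial labels [aP],
   [aQ] of its ends and the largest admitted label [aD]; [aIN], [aE], [aLK]:
   nodes, labels and links of the growing tree; [aFND], [aBC], [aBY], [aBZ]:
   whether it can be extended, with the least new label, from which old node to
   which new one; [aA], [aB]: distances from the two ends; [aFOUND], [aBD],
   [aON], [aOL]: whether a tree is recorded, half its diameter bound, its nodes
   and links. *)
Notation aL := 1 (only parsing).
Notation aED := 2 (only parsing).
Notation aX := 3 (only parsing).
Notation aINF := 4 (only parsing).
Notation aU := 5 (only parsing).
Notation aV := 6 (only parsing).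
Notation aP := 7 (only parsing).
Notation aQ := 8 (only parsing).
Notation aD := 9 (only parsing).
Notation aIN := 10 (only parsing).
Notation aE := 11 (only parsing).
Notation aLK := 12 (only parsing).
Notation aFND := 13 (only parsing).
Notation aBC := 14 (only parsing).
Notation aBY := 15 (only parsing).
Notation aBZ := 16 (only parsing).
Notation aC := 17 (only parsing).
Notation aA := 18 (only parsing).
Notation aB := 19 (only parsing).
Notation aCNT := 20 (only parsing).
Notation aFOUND := 21 (only parsing).
Notation aBD := 22 (only parsing).
Notation aON := 23 (only parsing).
Notation aOL := 24 (only parsing).

Definition get k := HArr k (HConst 0).
Definition set k e := CSet k (HConst 0) e.
(** Row-major index: the right factor is read from input cell 0, which holds [n]. *)
Definition entry y z := HAdd (HMulIn y (HConst 0)) z.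
Definition when e c := CIf e c CSkip.
(** Nonzero exactly when [e1 <= e2], since subtraction is truncated. *)
Definition leq_exp e1 e2 := HSub (HAdd e2 (HConst 1)) e1.
Fixpoint block cs := if cs is c :: cs' then CSeq c (block cs') else CSkip.

Definition clear_forest :=
  CSeq (CFor (CSet aIN (HVar 0) (HConst 0)))
       (CFor (CFor (CSet aLK (entry (HVar 1) (HVar 0)) (HConst 0)))).

Definition init_forest :=
  block [:: CSet aIN (get aU) (HConst 1); CSet aE (get aU) (get aP);
            CSet aIN (get aV) (HConst 1); CSet aE (get aV) (get aQ);
            CSet aLK (entry (get aU) (get aV)) (HConst 1);
            CSet aLK (entry (get aV) (get aU)) (HConst 1)].

(** [HVar 1] is the old node and [HVar 0] the new one. The sum in the last test is a disjunction:
    nothing is found yet, or the new label is strictly smaller. *)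
Definition relax :=
  when (HArr aIN (HVar 1)) (when (HArr aED (entry (HVar 1) (HVar 0)))
    (CIf (HArr aIN (HVar 0)) CSkip
      (CSeq (set aC (HAdd (HArr aE (HVar 1)) (HArr aX (entry (HVar 1) (HVar 0)))))
        (when (leq_exp (get aC) (get aD))
          (when (HAdd (HSub (HConst 1) (get aFND)) (HSub (get aBC) (get aC)))
            (block [:: set aFND (HConst 1); set aBC (get aC);
                       set aBY (HVar 1); set aBZ (HVar 0)])))))).

Definition search := CSeq (set aFND (HConst 0)) (CFor (CFor relax)).

Definition extend :=
  when (get aFND)
    (block [:: CSet aIN (get aBZ) (HConst 1); CSet aE (get aBZ) (get aBC);
               CSet aLK (entry (get aBY) (get aBZ)) (HConst 1);
               CSet aLK (entry (get aBZ) (get aBY)) (HConst 1)]).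

Definition dijkstra :=
  CSeq clear_forest (CSeq init_forest (CFor (CSeq search extend))).

Fixpoint writes (c : cmd) : seq nat :=
  match c with
  | CSkip => [::]
  | CSet k _ _ => [:: k]
  | COut _ _ => [:: 0]
  | CSeq c1 c2 | CIf _ c1 c2 => writes c1 ++ writes c2
  | CFor c => writes c
  end.

Lemma iteri_inv (P : nat -> state -> Prop) m f s : P 0 s ->
  (forall i s', i < m -> P i s' -> P i.+1 (f i s')) -> P m (iteri m f s).
Proof.
move=> P0; elim: m => [|m IH] Pf //=.
by apply: (Pf) => //; apply: IH => i s' im; apply: Pf; apply: ltnW.
Qed.

Lemma run_frame n env c s k : k \notin writes c -> run n env c s k = s k.
Proof.
elim: c env s => //= [k' a e|a e|c1 IH1 c2 IH2|e c1 IH1 c2 IH2|c IH] env s.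
- by rewrite inE /upd => /negPf->.
- by rewrite inE /upd => /negPf->.
- by rewrite mem_cat negb_or => /andP[k1 k2]; rewrite IH2 // IH1.
- by rewrite mem_cat negb_or => /andP[k1 k2]; case: ifP => _; [apply: IH1|apply: IH2].
- move=> kc; apply: (iteri_inv (P := fun _ s' => s' k = s k)) => // i s' _ <-.
  exact: IH.
Qed.

Lemma entry_eq n (x y x' y' : 'I_n) :
  (x * n + y == x' * n + y') = (x == x') && (y == y').
Proof.
apply/eqP/andP => [h|[/eqP-> /eqP->]] //.
have xx : x = x' :> nat.
  have n0 : 0 < n by apply: leq_ltn_trans (ltn_ord x).
  by have := congr1 (divn^~ n) h; rewrite /= !divnMDl // !divn_small // !addn0.
by split; apply/eqP/val_inj => //; move: h; rewrite /= xx => /addnI.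
Qed.

(* [M l] reads "a solution of value at most [l] is recorded", and [f] handles
   the candidates of value [l] for which [Q l]. *)
Definition advances (I : state -> Prop) (M : nat -> state -> Prop)
    (Q : nat -> Prop) (f : state -> state) : Prop :=
  forall s, I s ->
    [/\ I (f s), forall l, M l s -> M l (f s) & forall l, Q l -> M l (f s)].

Lemma advances_iteri m I M Q f : (forall i, i < m -> advances I M (Q i) (f i)) ->
  advances I M (fun l => exists2 i, i < m & Q i l) (iteri m f).
Proof.
elim: m => [|m IH] H s Is /=; first by split=> // l [].
have [|I1 M1 Q1] := IH _ s Is; first by move=> i im; apply: H; apply: ltnW.
have [I2 M2 Q2] := H m (ltnSn m) _ I1.
split=> // l; first by move/M1/M2.
case=> i; rewrite ltnS leq_eqVlt => /orP[/eqP->|im] Qi; first exact: Q2.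
by apply/M2/Q1; exists i.
Qed.

Section Dijkstra.
Variables (n : nat) (G : wgraph n) (X : 'I_n -> 'I_n -> nat).
Hypothesis X_sym : forall x y, edge G x y -> X x y = X y x.

Record graph_tables (s : state) : Prop := {
  gt_n : s 0 0 = n;
  gt_edge : forall x y : 'I_n, (s aED (x * n + y) != 0) = edge G x y;
  gt_X : forall x y : 'I_n, edge G x y -> s aX (x * n + y) = X x y
}.

Lemma graph_tables_eq s s' : s' 0 = s 0 -> s' aED = s aED -> s' aX = s aX ->
  graph_tables s -> graph_tables s'.
Proof. by move=> e0 e1 e2 [h0 h1 h2]; split; rewrite ?e0 ?e1 ?e2. Qed.

Definition eligible (s : state) (y z : 'I_n) :=
  [&& s aIN y != 0, edge G y z, s aIN z == 0 & s aE y + X y z <= s aD 0].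

(** Eligibility can refer to the starting state throughout, because the two loops write none of the
    arrays it reads. *)
Lemma search_spec env s (s' := run n env search s) : graph_tables s ->
  (s' aFND 0 = 0 /\ forall y z, ~~ eligible s y z) \/
  (s' aFND 0 = 1 /\ exists y z, [/\ eligible s y z, s' aBY 0 = y, s' aBZ 0 = z,
     s' aBC 0 = s aE y + X y z &
     forall y' z', eligible s y' z' -> s aE y + X y z <= s aE y' + X y' z']).
Proof.
move=> gs.
pose same (t : state) := [/\ t 0 = s 0, t aED = s aED, t aX = s aX & 
   [/\ t aIN = s aIN, t aE = s aE & t aD = s aD]].
pose I t := same t /\ (t aFND 0 = 0 \/ (t aFND 0 = 1 /\ exists y z : 'I_n,
  [/\ eligible s y z, t aBY 0 = y, t aBZ 0 = z & t aBC 0 = s aE y + X y z])).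
pose M l (t : state) := t aFND 0 = 1 /\ t aBC 0 <= l.
pose Q i j l := exists y z : 'I_n, [/\ y = i :> nat, z = j :> nat, eligible s y z
  & l = s aE y + X y z].
have body i j : i < n -> j < n ->
    advances I M (Q i j) (run n [:: j, i & env] relax).
  move=> lin ljn t [[t0 tED tX [tIN tE tD]] tF].
  have sm (t' : state) : t' 0 = t 0 -> t' aED = t aED -> t' aX = t aX ->
      t' aIN = t aIN -> t' aE = t aE -> t' aD = t aD -> same t'.
    by move=> *; split; [..|split]; congruence.
  pose y := Ordinal lin; pose z := Ordinal ljn.
  have n0 : t 0 0 = n by rewrite t0 (gt_n gs).
  have QE l : Q i j l -> eligible s y z /\ l = s aE y + X y z.
    move=> [y' [z' [yE zE el ->]]].
    have -> : y = y' by apply: val_inj.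
    by have -> : z = z' by apply: val_inj.
  have skip : ~~ eligible s y z -> [/\ I t, forall l, M l t -> M l t & forall l, Q i j l -> M l t].
    by move=> nel; split=> // l /QE[el]; rewrite el in nel.
  rewrite /= min0n n0.
  case: eqP => [yin|/eqP yin] /=.
    by apply: skip; rewrite /eligible -tIN /= yin.
  case: eqP => [yz|/eqP yz] /=.
    by apply: skip; rewrite /eligible -(gt_edge gs) /= -tED yz eqxx andbF.
  have eyz : edge G y z by rewrite -(gt_edge gs) -tED.
  case: eqP => [zin|/eqP zin] /=; last first.
    by apply: skip; rewrite /eligible -tIN /= (negPf zin) !andbF.
  have XE : t aX (i * n + j) = X y z by rewrite tX -(gt_X gs).
  rewrite /upd /= /update /= XE.
  case: eqP => [cD|/eqP cD] /=.
    have nel : ~~ eligible s y z.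
      rewrite /eligible -tE -tD /=; apply/negP => /and4P[_ _ _]; lia.
    split; [split; [exact: sm | exact: tF] | by [] |].
    by move=> l /QE[el]; rewrite el in nel.
  have el : eligible s y z.
    rewrite /eligible -tE -tD -tIN /= zin eqxx yin eyz /=; lia.
  rewrite tE in cD *.
  case: eqP => [cB|/eqP cB] /=.
    split; [split; [exact: sm | exact: tF] | by [] |].
    move=> l /QE[_ ->]; move: cB; rewrite /M /=.
    case: tF => [-> //|[-> _]]; split=> //; move: cB => /=; lia.
  split.
  - split; [exact: sm | right; split=> //].
    by exists y, z.
  - rewrite /M /= => l [tF1 tl]; split=> //; rewrite tF1 in cB; lia.
  - by move=> l /QE[_ ->]; split.
have adv : advances I M (fun l => exists2 i, i < n & exists2 j, j < n & Q i j l)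
    (iteri n (fun i => run n (i :: env) (CFor relax))).
  apply: advances_iteri => i lin; apply: advances_iteri => j ljn; exact: body.
have I0 : I (run n env (set aFND (HConst 0)) s) by split; [split | left].
have [[same' I'] _ Q'] : [/\ I s', forall l, _ -> M l s' & forall l, _ -> M l s'] :=
  adv _ I0.
have Qel y z : eligible s y z -> M (s aE y + X y z) s'.
  by move=> el; apply: Q'; exists y => //; exists z => //; exists y, z.
case: I' => [F0|[F1 [y [z [el bY bZ bC]]]]].
  by left; split=> // y z; apply/negP => /Qel []; rewrite F0.
right; split=> //; exists y, z; split=> // y' z' /Qel [_].
by rewrite bC.
Qed.


Definition forest_tree (s : state) kn kl : subgraph n :=
  Subgraph [set x : 'I_n | s kn x != 0] (fun x y : 'I_n => s kl (x * n + y) != 0).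

Lemma clear_forest_spec env s (s' := run n env clear_forest s) : s 0 0 = n ->
  (forall x : 'I_n, s' aIN x = 0) /\
  (forall x y : 'I_n, s' aLK (x * n + y) = 0).
Proof.
move=> n0; pose I (t : state) := t 0 0 = n.
pose M k e (t : state) := t k e = 0.
have adv1 : advances I (M aIN) (fun e => exists2 i, i < n & e = i)
    (run n env (CFor (CSet aIN (HVar 0) (HConst 0)))).
  apply: advances_iteri => i _ t tn.
  rewrite /I /M /= /upd /= /update; split=> // e; last by move=> ->; rewrite eqxx.
  by case: (e == i).
have adv2 : advances I (M aLK)
    (fun e => exists2 i, i < n & exists2 j, j < n & e = i * n + j)
    (run n env (CFor (CFor (CSet aLK (entry (HVar 1) (HVar 0)) (HConst 0))))).
  apply: advances_iteri => i _; apply: advances_iteri => j _ t tn.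
  rewrite /I /M /= min0n tn /upd /= /update; split=> // e.
    by case: (e == _).
  by move=> ->; rewrite eqxx.
have [I1 _ Q1] := adv1 s n0; have [_ _ Q2] := adv2 _ I1.
split=> [x|x y]; last by apply: Q2; exists x => //; exists y.
have -> : s' aIN = run n env (CFor (CSet aIN (HVar 0) (HConst 0))) s aIN.
  exact: (@run_frame n env (CFor (CFor (CSet aLK _ _)))).
by apply: Q1; exists x.
Qed.

(** * Invariants of the growing tree *)

Section Run.
Variables (u v : 'I_n) (p q D : nat).
Hypotheses (uv : edge G u v) (uv_leq : X u v <= p + q).

(** [gr_tree] yields the diameter bound; [gr_settled] yields the minimality of labels. The ends are
    exempt from [gr_leq], [gr_settled] and the settled side of [gr_pending], as their labels are
    imposed rather than computed. *)
Record grown (s : state) : Prop := {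
  gr_tables : graph_tables s;
  gr_D : s aD 0 = D;
  gr_tree : tree_within G X (fun x y => s aE x + s aE y) (forest_tree s aIN aLK);
  gr_u : s aIN u != 0 /\ s aE u = p;
  gr_v : s aIN v != 0 /\ s aE v = q;
  gr_reach : forall x : 'I_n, s aIN x != 0 -> reach G X u v p q D x (s aE x);
  gr_leq : forall x : 'I_n, s aIN x != 0 -> x != u -> x != v -> s aE x <= D;
  gr_settled : forall x y : 'I_n, s aIN x != 0 -> s aIN y != 0 -> y != u -> y != v ->
    edge G x y -> s aE y <= s aE x + X x y;
  (* Dijkstra's monotonicity: settled labels are at most the pending ones. *)
  gr_pending : forall x y z : 'I_n, s aIN x != 0 -> x != u -> x != v ->
    s aIN y != 0 -> s aIN z = 0 -> edge G y z -> s aE x <= s aE y + X y z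
}.

Lemma init_forest_spec env s :
  graph_tables s -> s aU 0 = u -> s aV 0 = v -> s aP 0 = p -> s aQ 0 = q ->
  s aD 0 = D -> grown (run n env (CSeq clear_forest init_forest) s).
Proof.
move=> gs sU sV sP sQ sD.
have [clIN clLK] := clear_forest_spec env (gt_n gs).
have fr k : k \notin [:: aIN; aLK] -> run n env clear_forest s k = s k.
  by move=> kN; apply: run_frame; exact: kN.
change (run n env (CSeq clear_forest init_forest) s) with
  (run n env init_forest (run n env clear_forest s)).
move: (run n env clear_forest s) clIN clLK fr => t tIN tLK fr.
have gt : graph_tables t by apply: graph_tables_eq gs; rewrite fr.
have uNv : (u == v) = false by apply: contraTF uv => /eqP->; rewrite edge_irr.
rewrite -fr // in sU; rewrite -fr // in sV; rewrite -fr // in sP.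
rewrite -fr // in sQ; rewrite -fr // in sD.
have INE (x : 'I_n) : run n env init_forest t aIN x = (x == u) || (x == v).
  rewrite /= /upd /= /update sU sV /= !(inj_eq val_inj) tIN.
  by case: (x == v); rewrite ?orbT ?orbF //; case: (x == u).
have LKE (x y : 'I_n) : run n env init_forest t aLK (x * n + y) =
    ((x == u) && (y == v)) || ((x == v) && (y == u)).
  rewrite /= /upd /= /update /= !min0n (gt_n gt) sU sV !entry_eq tLK.
  by do 2!case: (_ && _).
have Eu : run n env init_forest t aE u = p.
  by rewrite /= /upd /= /update /= sU sV sP sQ (inj_eq val_inj) uNv eqxx.
have Ev : run n env init_forest t aE v = q.
  by rewrite /= /upd /= /update /= sU sV sP sQ eqxx.
have only (x : 'I_n) : run n env init_forest t aIN x != 0 -> x != u -> x != v -> False.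
  by rewrite INE; case: (x == u); case: (x == v).
split.
- by apply: graph_tables_eq gt; rewrite /= /upd /=.
- by rewrite -sD.
- have -> : forest_tree (run n env init_forest t) aIN aLK = add_leaf (point_tree u) u v.
    rewrite /forest_tree /add_leaf; congr Subgraph.
      by apply/setP=> x; rewrite !inE INE; case: (x == u); case: (x == v).
    apply: functional_extensionality => x; apply: functional_extensionality => y.
    by rewrite LKE; do 2!case: (_ && _).
  (* The edge [uv] is the leaf [v] attached to the single node [u]; the condition becomes
     [X u v <= p + q]. *)
  apply: (@add_leaf_within n G X X_sym (fun _ _ => 0)) => //.
  + exact: point_tree_within.
  + by rewrite inE.
  + by rewrite inE eq_sym uNv.
  + by move=> a; rewrite inE => /eqP->; rewrite Eu Ev add0n addnC; split=> //; rewrite addnC.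
- by rewrite INE eqxx.
- by rewrite INE eqxx orbT.
- move=> x; rewrite INE; case: (x =P u) => [-> _|_]; first by rewrite Eu; exact: reach_left.
  by case: (x =P v) => [-> _|//]; rewrite Ev; exact: reach_right.
- by move=> x h1 h2 h3; case: (only x).
- by move=> x y _ h1 h2 h3; case: (only y).
- by move=> x y z h1 h2 h3; case: (only x).
Qed.

(** The second conclusion measures progress: a round either leaves nothing eligible or adds a
    node. *)
Lemma extend_spec env s (s' := run n env (CSeq search extend) s) : grown s ->
  grown s' /\
  ((forall y z, ~~ eligible s' y z) \/
   (exists y z, eligible s y z) /\
   #|nodes (forest_tree s' aIN aLK)| = #|nodes (forest_tree s aIN aLK)|.+1).
Proof.
move=> gs; have := search_spec env (gr_tables gs).
have fr k : k \notin [:: aFND; aC; aFND; aBC; aBY; aBZ] -> run n env search s k = s k.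
  by move=> kN; apply: run_frame; exact: kN.
rewrite {}/s'; change (run n env (CSeq search extend) s) with
  (run n env extend (run n env search s)).
move: (run n env search s) fr => t fr.
have tIN : t aIN = s aIN by apply: fr.
have tE : t aE = s aE by apply: fr.
have tLK : t aLK = s aLK by apply: fr.
have tD : t aD = s aD by apply: fr.
case=> [[F0 nel]|[F1 [y [z [el bY bZ bC best]]]]].
  have -> : run n env extend t = t by rewrite /= F0.
  split; last by left=> y z; have := nel y z; rewrite /eligible tIN tE tD.
  case: gs => g1 g2 g3 g4 g5 g6 g7 g8 g9; split; rewrite ?tIN ?tE ?tD //.
    by apply: graph_tables_eq g1; apply: fr.
  by rewrite /forest_tree tIN tLK.
have gt : graph_tables t by apply: graph_tables_eq (gr_tables gs); apply: fr.
set s' := run n env extend t.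
have INE (x : 'I_n) : s' aIN x = if x == z then 1 else s aIN x.
  by rewrite /s' /= F1 /= /upd /= /update /= bZ (inj_eq val_inj) tIN.
have EE (x : 'I_n) : s' aE x = if x == z then s aE y + X y z else s aE x.
  by rewrite /s' /= F1 /= /upd /= /update /= bZ (inj_eq val_inj) tE bC.
have LKE (a b : 'I_n) : s' aLK (a * n + b) =
    if ((a == z) && (b == y)) || ((a == y) && (b == z)) then 1 else s aLK (a * n + b).
  rewrite /s' /= F1 /= /upd /= /update /= !min0n (gt_n gt) bZ bY !entry_eq tLK.
  by do 2!case: (_ && _).
have D' : s' aD 0 = D by rewrite /s' /= F1 /= /upd /= tD (gr_D gs).
have tables' : graph_tables s'.
  by apply: graph_tables_eq gt; rewrite /s' /= F1.
have /and4P[yin yz /eqP zout yzD] := el.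
have zNin (x : 'I_n) : s aIN x != 0 -> (x == z) = false.
  by apply: contraNF => /eqP->; rewrite zout.
have treeE : forest_tree s' aIN aLK = add_leaf (forest_tree s aIN aLK) y z.
  rewrite /forest_tree /add_leaf; congr Subgraph.
    by apply/setP=> x; rewrite !inE INE; case: (x == z).
  apply: functional_extensionality => a; apply: functional_extensionality => b.
  rewrite LKE /=; do 2!case: (_ && _); rewrite ?orbT ?orbF //.
have [uin up] := gr_u gs; have [vin vq] := gr_v gs.
split; last first.
  right; split; first by exists y, z.
  by rewrite treeE /= cardsU1 inE zout.
split=> //.
- rewrite treeE; apply: (add_leaf_within X_sym (gr_tree gs)) => //.
  + by rewrite inE.
  + by rewrite inE zout.
  + by move=> a b; rewrite !inE !EE => /zNin-> /zNin->.
  + move=> a; rewrite inE => /zNin az; rewrite !EE az eqxx; lia.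
- by rewrite INE EE zNin.
- by rewrite INE EE zNin.
- move=> x; rewrite INE EE; case: (x =P z) => [-> _|_]; last exact: (gr_reach gs).
  apply: (reach_step (gr_reach gs yin) yz); rewrite -?(gr_D gs) //.
    by rewrite eq_sym zNin.
  by rewrite eq_sym zNin.
- move=> x; rewrite INE EE; case: (x =P z) => [_ _ _ _|_]; last exact: (gr_leq gs).
  by rewrite -(gr_D gs).
- move=> a b; rewrite !INE !EE; case: (a =P z) => [->|_]; case: (b =P z) => [->|_] //.
  + by move=> *; lia.
  (* Here [a] is the new node: the label of [b], settled earlier, is at most the label with which
     [z] was pending. *)
  + by move=> _ bin bu bv ab; apply: leq_trans (gr_pending gs bin bu bv yin zout yz) (leq_addr _ _).
  (* Here [b] is the new node: the competing edge is either eligible, hence no better than the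
     chosen one, or over the threshold, which the chosen label respects. *)
  + move=> ain _ zu zv az.
    case: (leqP (s aE a + X a z) (s aD 0)) => aD; last by apply: leq_trans yzD (ltnW aD).
    by apply: best; rewrite /eligible ain az zout eqxx.
  + exact: (gr_settled gs).
- move=> a b c; rewrite !INE !EE; case: (c =P z) => [//|_].
  have lab (b0 : 'I_n) : s aIN b0 != 0 -> edge G b0 c -> s aIN c = 0 ->
      s aE y + X y z <= s aE b0 + X b0 c.
    move=> b0in b0c cout; case: (leqP (s aE b0 + X b0 c) (s aD 0)) => [bD|/ltnW bD].
    2: exact: leq_trans yzD bD.
    by apply: best; rewrite /eligible b0in b0c cout eqxx.
  case: (a =P z) => [->|_]; case: (b =P z) => [->|_].
  + by move=> *; apply: leq_addr.
  + by move=> _ _ _ bin cout bc; apply: lab.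
  + move=> ain au av _ cout zc; apply: leq_trans (leq_addr _ _).
    exact: (gr_pending gs ain au av yin zout yz).
  + exact: (gr_pending gs).
Qed.

(** Unless saturated, the tree has more than [i] nodes after [i] rounds, so [n] rounds saturate it.
    Every label given by [reach] is then dominated, by induction along the walk. *)
Lemma dijkstra_spec env s (s' := run n env dijkstra s) :
  graph_tables s -> s aU 0 = u -> s aV 0 = v -> s aP 0 = p -> s aQ 0 = q ->
  s aD 0 = D ->
  grown s' /\ forall z l, reach G X u v p q D z l -> s' aIN z != 0 /\ s' aE z <= l.
Proof.
move=> gs sU sV sP sQ sD.
have := init_forest_spec env gs sU sV sP sQ sD; rewrite {}/s'.
change (run n env dijkstra s) with (iteri n (fun i => run n (i :: env) (CSeq search extend))
  (run n env (CSeq clear_forest init_forest) s)).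
move: (run n env _ s) => t gt; set s' := iteri n _ t.
have [gs' [sat|]] : grown s' /\ ((forall y z, ~~ eligible s' y z) \/
    n < #|nodes (forest_tree s' aIN aLK)|).
- apply: (iteri_inv (P := fun i s' => grown s' /\ ((forall y z, ~~ eligible s' y z) \/
    i < #|nodes (forest_tree s' aIN aLK)|))).
    split=> //; right; apply/card_gt0P; exists u; rewrite inE; by case: (gr_u gt).
  move=> i t' _ [gt' tP]; have [g1 [g2|[[y [z el]] ->]]] := extend_spec (i :: env) gt'.
    by split=> //; left.
  by split=> //; case: tP => [/(_ y z)|h]; [rewrite el | right].
- split=> // z l; elim=> [||y w k _ [yin yk] yw wu wv kD].
  + by have [h <-] := gr_u gs'.
  + by have [h <-] := gr_v gs'.
  + have win : s' aIN w != 0.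
      apply/eqP => win; have := sat y w.
      by rewrite /eligible yin yw win eqxx (gr_D gs') /= (leq_trans _ kD) // leq_add2r.
    split=> //; apply: leq_trans (gr_settled gs' yin win wu wv yw) _.
    by rewrite leq_add2r.
- by have := max_card (nodes (forest_tree s' aIN aLK)); rewrite card_ord ltnNge => ->.
Qed.

End Run.
End Dijkstra.

(** * The search *)

(** Matrix entry [e] occupies cells [2 + 2e] and [3 + 2e], after [n] and the bound. A zero
    denominator marks a missing edge. *)
Definition input_at c e := HAdd (HConst c) (HAdd e e).
Notation here := (entry (HVar 1) (HVar 0)).
Notation num_at := (input_at 2 here).
Notation den_at := (input_at 3 here).

(** The product of all denominators instead of their least common multiple: it takes one
    multiplication by an input cell per edge entry, as the growth criterion demands. *)
Definition scale :=
  CSeq (set aL (HConst 1))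
       (CFor (CFor (when (HIn den_at) (set aL (HMulIn (get aL) den_at))))).

Definition scaled_weight := HMulIn (HDiv (get aL) (HIn den_at)) num_at.

Definition tabulate :=
  CFor (CFor (when (HIn den_at)
    (block [:: CSet aED here (HConst 1);
               CSet aX here (HAdd scaled_weight scaled_weight);
               set aINF (HAdd (get aINF) (HArr aX here))]))).

(** By now [aINF] holds the sum of all scaled weights. The factor [n] covers the edges of a simple
    path, and the final 1 makes the value positive even without edges. *)
Definition infinity := set aINF (HAdd (HMulIn (get aINF) (HConst 0)) (HConst 1)).

Lemma entry_lt n i j : i < n -> j < n -> i * n + j < n * n.
Proof.
move=> lin ljn; apply: (@leq_trans (i.+1 * n)); last by rewrite leq_mul.
by rewrite mulSn addnC ltn_add2r.
Qed.

Lemma input_min n e c : e < n * n -> c <= 3 ->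
  minn (c + (e + e)) (2 * (n * n) + 1) = c + (e + e).
Proof. by move=> en c3; apply/minn_idPl; lia. Qed.

Section Prep.
Variables (n : nat) (s0 : state).
Hypotheses (s0n : s0 0 0 = n) (s0ED : forall e, s0 aED e = 0).

Let num e := s0 0 (2 + (e + e)).
Let den e := s0 0 (3 + (e + e)).

Lemma scale_spec env (s := run n env scale s0) :
  [/\ forall k, k != aL -> s k = s0 k, 0 < s aL 0 &
      forall i j, i < n -> j < n -> den (i * n + j) != 0 -> den (i * n + j) %| s aL 0].
Proof.
have fr k : k != aL -> s k = s0 k.
  by move=> /negPf kL; apply: run_frame; rewrite /= !inE kL.
pose I (t : state) := t 0 = s0 0 /\ 0 < t aL 0.
pose M l (t : state) := l %| t aL 0.
pose Q i j l := den (i * n + j) != 0 /\ l = den (i * n + j).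
have body i j : i < n -> j < n -> advances I M (Q i j)
    (run n [:: j, i & env] (when (HIn den_at) (set aL (HMulIn (get aL) den_at)))).
  move=> lin ljn t [t0 tL]; have e_lt := entry_lt lin ljn.
  rewrite /= !min0n t0 s0n input_min // -/(den _).
  case: eqP => [d0|/eqP d0] /=.
    by split=> // l [h]; rewrite d0 in h.
  split; first by split=> //; rewrite /upd /= /update /= muln_gt0 tL lt0n.
  - by move=> l; rewrite /M /upd /= /update /=; apply: dvdn_mulr.
  - by move=> l [_ ->]; rewrite /M /upd /= /update /=; apply: dvdn_mull.
have adv : advances I M (fun l => exists2 i, i < n & exists2 j, j < n & Q i j l)
    (run n env (CFor (CFor (when (HIn den_at) (set aL (HMulIn (get aL) den_at)))))).
  apply: advances_iteri => i lin; apply: advances_iteri => j ljn; exact: body.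
have I0 : I (run n env (set aL (HConst 1)) s0) by [].
have [[_ L0] _ Q'] : [/\ I s, forall l, _ -> M l s & forall l, _ -> M l s] := adv _ I0.
split=> // i j lin ljn dij.
by apply: Q'; exists i => //; exists j.
Qed.

Let s1 := run n [::] scale s0.
Let w e := (s1 aL 0 %/ den e * num e).*2.
Let s2 := run n [::] (block [:: scale; tabulate; infinity]) s0.

Lemma tables_spec :
  [/\ s2 0 = s0 0, s2 aL = s1 aL,
      forall i j, i < n -> j < n -> (s2 aED (i * n + j) != 0) = (den (i * n + j) != 0) &
      forall i j, i < n -> j < n -> den (i * n + j) != 0 ->
        s2 aX (i * n + j) = w (i * n + j) /\ n * w (i * n + j) < s2 aINF 0].
Proof.
have [fr1 L0 Ldvd] := scale_spec [::]; rewrite -/s1 in fr1 L0 Ldvd.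
pose I (t : state) := [/\ t 0 = s0 0, t aL = s1 aL & forall e, t aED e != 0 -> den e != 0].
pose M e (t : state) := den e != 0 -> [/\ t aED e != 0, t aX e = w e & w e <= t aINF 0].
pose Q i j e := e = i * n + j.
have body i j : i < n -> j < n -> advances I M (Q i j)
    (run n [:: j, i & [::]] (when (HIn den_at)
    (block [:: CSet aED here (HConst 1);
               CSet aX here (HAdd scaled_weight scaled_weight);
               set aINF (HAdd (get aINF) (HArr aX here))]))).
  move=> lin ljn t [t0 tL tED]; have e_lt := entry_lt lin ljn.
  rewrite /= !min0n t0 s0n input_min // -/(den _).
  case: eqP => [d0|/eqP d0] /=.
    by split=> // l -> h; rewrite d0 in h.
  rewrite /upd /= /update /= t0 tL !s0n !input_min // -/(num _) -/(den _) eqxx addnn -/(w _).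
  split.
  - split=> //= e; case: (e =P i * n + j) => [->|_] //; exact: tED.
  - rewrite /M => e tM de; have [h1 h2 h3] := tM de; have [->|/negPf ne] := eqVneq e (i * n + j);
      rewrite /= ?eqxx ?ne.
      by split=> //; rewrite leq_addl.
    by split=> //; apply: leq_trans h3 (leq_addr _ _).
  - by move=> e -> _; rewrite /= !eqxx; split=> //; rewrite leq_addl.
have adv : advances I M (fun l => exists2 i, i < n & exists2 j, j < n & Q i j l)
    (run n [::] tabulate).
  apply: advances_iteri => i lin; apply: advances_iteri => j ljn; exact: body.
have I1 : I s1 by split=> // [|e]; rewrite fr1 // s0ED.
have [[t0 tL tED] _ MQ] := adv s1 I1.
have -> : s2 = run n [::] infinity (run n [::] tabulate s1) by [].
move: (run n [::] tabulate s1) t0 tL tED MQ => t t0 tL tED MQ.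
rewrite /= /upd /= /update /= min0n t0 s0n; split=> // i j lin ljn.
  apply/idP/idP => [|dij]; first exact: tED.
  by have [|//] := MQ (i * n + j) _ dij; exists i => //; exists j.
move=> dij; have [|_ -> wI] := MQ (i * n + j) _ dij; first by exists i => //; exists j.
by split=> //; rewrite addn1 ltnS mulnC leq_mul.
Qed.

End Prep.

(** * Trying pairs of radii at an edge *)

Definition copy k k' := CFor (CSet k (HVar 0) (HArr k' (HVar 0))).
Definition copy_matrix k k' := CFor (CFor (CSet k here (HArr k' here))).
Definition is_shorter := HAdd (HSub (HConst 1) (get aFOUND)) (HSub (get aBD) (get aD)).

(** [D + (a - D)] with truncated subtraction is a maximum. The half is rounded up so that the
    initial labels [D - a] and [D - b] always sum to at least the weight of [uv]. *)
Definition set_radii :=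
  block [::
    set aD (HDiv (HAdd (HAdd (HAdd (HArr aA (HVar 1)) (HArr aB (HVar 0)))
                             (HArr aX (entry (get aU) (get aV)))) (HConst 1)) (HConst 2));
    set aD (HAdd (get aD) (HSub (HArr aA (HVar 1)) (get aD)));
    set aD (HAdd (get aD) (HSub (HArr aB (HVar 0)) (get aD)));
    set aP (HSub (get aD) (HArr aA (HVar 1)));
    set aQ (HSub (get aD) (HArr aB (HVar 0)))].

Definition count_nodes :=
  CSeq (set aCNT (HConst 0))
       (CFor (when (HArr aIN (HVar 0)) (set aCNT (HAdd (get aCNT) (HConst 1))))).

Definition record_tree :=
  block [:: set aFOUND (HConst 1); set aBD (get aD); copy aON aIN; copy_matrix aOL aLK].

Definition try_radii :=
  block [:: set_radii; dijkstra; count_nodes;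
    when (leq_exp (HIn (HConst 1)) (get aCNT)) (when is_shorter record_tree)].

Definition try_edge :=
  when (HArr aED here)
    (block [:: set aU (HVar 1); set aV (HVar 0); set aD (HSub (get aINF) (HConst 1));
       set aP (HConst 0); set aQ (get aINF); dijkstra; copy aA aE;
       set aP (get aINF); set aQ (HConst 0); dijkstra; copy aB aE;
       CFor (CFor try_radii)]).

(* Every tree with two nodes has a central edge: only [k = 1] needs this. *)
Definition single_node :=
  CFor (when (HSub (HConst 2) (HIn (HConst 1)))
    (block [:: set aFOUND (HConst 1); CSet aON (HConst 0) (HConst 1)])).

Lemma copy_spec n env s k k' (x : nat) : k != k' -> x < n ->
  run n env (copy k k') s k x = s k' x.
Proof.
move=> kk xn; pose I (t : state) := t k' = s k'.
pose M e (t : state) := t k e = s k' e.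
have adv : advances I M (fun e => exists2 i, i < n & e = i) (run n env (copy k k')).
  apply: advances_iteri => i lin t tk'; rewrite /= tk'; split.
  - by rewrite /I /upd [k' == k]eq_sym (negPf kk).
  - by rewrite /M /upd eqxx /update => e te; case: eqP => [->|].
  - by rewrite /M /upd eqxx /update => e ->; rewrite eqxx.
by have [|_ _ H] := adv s; [by [] | apply: H; exists x].
Qed.

Lemma copy_matrix_spec n env s k k' (x y : 'I_n) : s 0 0 = n -> 0 < k -> k != k' ->
  run n env (copy_matrix k k') s k (x * n + y) = s k' (x * n + y).
Proof.
move=> s0n k0 kk.
pose I (t : state) := t 0 = s 0 /\ t k' = s k'.
pose M e (t : state) := t k e = s k' e.
pose Q i j e := e = i * n + j.
have adv : advances I M (fun l => exists2 i, i < n & exists2 j, j < n & Q i j l)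
    (run n env (copy_matrix k k')).
  apply: advances_iteri => i lin; apply: advances_iteri => j ljn t [t0 tk'].
  rewrite /= min0n t0 s0n tk'; split.
  - by rewrite /I /upd (ltn_eqF k0) [k' == k]eq_sym (negPf kk).
  - by rewrite /M /upd eqxx /update => e te; case: eqP => [->|].
  - by rewrite /M /upd eqxx /update => e ->; rewrite eqxx.
have [|_ _ H] := adv s; first by [].
by apply: H; exists x => //; exists y.
Qed.

Lemma count_nodes_spec n env s (s' := run n env count_nodes s) :
  s' aCNT 0 = #|[set x : 'I_n | s aIN x != 0]|.
Proof.
pose f i := run n (i :: env) (when (HArr aIN (HVar 0)) (set aCNT (HAdd (get aCNT) (HConst 1)))).
have [_ H] : (iteri n f (run n env (set aCNT (HConst 0)) s)) aIN = s aIN /\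
   (iteri n f (run n env (set aCNT (HConst 0)) s)) aCNT 0 = \sum_(0 <= i < n) (s aIN i != 0).
  apply: (iteri_inv (P := fun i t => t aIN = s aIN /\ t aCNT 0 = \sum_(0 <= j < i) (s aIN j != 0))).
    by rewrite big_geq.
  move=> i t _ [tI tC]; rewrite /f /= tI big_nat_recr //=.
  case: (s aIN i == 0) => /=; first by rewrite addn0.
  by rewrite /upd /= /update /= tI tC.
rewrite /s' [LHS]H big_mkord -sum1dep_card [RHS]big_mkcond /=.
by apply: eq_bigr => x _; case: (_ == _).
Qed.

Section Main.
Variables (n : nat) (G : wgraph n) (X : 'I_n -> 'I_n -> nat) (inf k : nat).
Hypothesis X_sym : forall x y, edge G x y -> X x y = X y x.
Hypothesis X_inf : forall x y, edge G x y -> X x y <= inf.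

Definition threshold a b x := maxn (maxn ((a + b + x + 1) %/ 2) a) b.

Definition good_tree d (T : subgraph n) :=
  tree_within G X (fun _ _ => 2 * d) T /\ k <= #|nodes T|.

Definition best_so_far (s : state) :=
  [/\ graph_tables G X s, s 0 1 = k, s aINF 0 = inf &
      s aFOUND 0 = 0 \/ s aFOUND 0 = 1 /\ good_tree (s aBD 0) (forest_tree n s aON aOL)].

Definition found_within l (s : state) := s aFOUND 0 = 1 /\ s aBD 0 <= l.

Lemma tree_within_leq F F' T : tree_within G X F T ->
  {in nodes T &, forall x y, F x y <= F' x y} -> tree_within G X F' T.
Proof.
move=> [h1 h2 h3] FF; split=> // x y p xT yT xy.
exact: leq_trans (h3 _ _ _ xT yT xy) (FF _ _ xT yT).
Qed.

Lemma record_tree_spec env s (s' := run n env record_tree s) : graph_tables G X s ->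
  [/\ s' aFOUND 0 = 1, s' aBD 0 = s aD 0 &
      forest_tree n s' aON aOL = forest_tree n s aIN aLK].
Proof.
move=> gs.
pose t1 := run n env (block [:: set aFOUND (HConst 1); set aBD (get aD)]) s.
pose t2 := run n env (copy aON aIN) t1.
have s'E : s' = run n env (copy_matrix aOL aLK) t2 by [].
have fr1 j : j \notin [:: aFOUND; aBD] -> t1 j = s j.
  by move=> jN; apply: run_frame; exact: jN.
have fr2 j : j \notin [:: aON] -> t2 j = t1 j.
  by move=> jN; apply: run_frame; exact: jN.
have fr3 j : j \notin [:: aOL] -> s' j = t2 j.
  by move=> jN; rewrite s'E; apply: run_frame; exact: jN.
split.
- by rewrite fr3 // fr2 // /t1 /= /upd /= /update.
- by rewrite fr3 // fr2 // /t1 /= /upd /= /update.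
- rewrite /forest_tree; congr Subgraph.
    by apply/setP=> x; rewrite !inE fr3 // /t2 copy_spec // fr1.
  apply: functional_extensionality => x; apply: functional_extensionality => y.
  rewrite s'E copy_matrix_spec ?fr2 ?fr1 //; exact: gt_n gs.
Qed.

(** The radii are arbitrary numbers here: whatever they are, a recorded tree is sound. So entries of
    [aE] left over at nodes that were not reached do no harm when used as radii. *)
Lemma try_radii_spec (u v : 'I_n) (fA fB : nat -> nat) i j env : edge G u v ->
  advances
    (fun s => best_so_far s /\ [/\ s aU 0 = u, s aV 0 = v, s aA = fA & s aB = fB])
    found_within
    (fun l => let D := threshold (fA i) (fB j) (X u v) in l = D /\
       exists2 W : {set 'I_n}, k <= #|W| &
         forall z, z \in W -> exists m, reach G X u v (D - fA i) (D - fB j) D z m)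
    (run n [:: j, i & env] try_radii).
Proof.
move=> uv s [[gs s1 sinf sF] [sU sV sA sB]]; set env' := [:: j, i & env].
set D := threshold (fA i) (fB j) (X u v).
pose t1 := run n env' set_radii s; pose t2 := run n env' dijkstra t1.
pose t3 := run n env' count_nodes t2.
have [t1D t1P t1Q] : [/\ t1 aD 0 = D, t1 aP 0 = D - fA i & t1 aQ 0 = D - fB j].
  rewrite /t1 /= /upd /= /update /= !min0n (gt_n gs) sU sV sA sB (gt_X gs uv).
  by rewrite /D /threshold !maxnE.
have fr1 x : x \notin [:: aD; aD; aD; aP; aQ] -> t1 x = s x.
  by move=> xN; apply: run_frame; exact: xN.
have fr2 x : x \notin writes dijkstra -> t2 x = t1 x by move=> xN; apply: run_frame.
have fr3 x : x \notin [:: aCNT; aCNT] -> t3 x = t2 x.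
  by move=> xN; apply: run_frame; exact: xN.
have uv_leq : X u v <= (D - fA i) + (D - fB j).
  have := leq_maxl (maxn ((fA i + fB j + X u v + 1) %/ 2) (fA i)) (fB j).
  have := leq_maxr (maxn ((fA i + fB j + X u v + 1) %/ 2) (fA i)) (fB j).
  have := leq_maxl ((fA i + fB j + X u v + 1) %/ 2) (fA i).
  have := leq_maxr ((fA i + fB j + X u v + 1) %/ 2) (fA i).
  rewrite -/(threshold _ _ _) -/D; lia.
have gt1 : graph_tables G X t1 by apply: graph_tables_eq gs; apply: fr1.
have [] := dijkstra_spec X_sym uv uv_leq env' gt1 _ _ t1P t1Q t1D; rewrite ?fr1 //.
rewrite -/t2 => gr compl.
have tree2 : tree_within G X (fun _ _ => 2 * D) (forest_tree n t2 aIN aLK).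
  apply: tree_within_leq (gr_tree gr) _ => x y; rewrite !inE => xin yin.
  have le (z : 'I_n) : t2 aIN z != 0 -> t2 aE z <= D.
    move=> zin; case: (z =P u) => [->|/eqP zu].
      by have [_ ->] := gr_u gr; apply: leq_subr.
    case: (z =P v) => [->|/eqP zv]; last exact: gr_leq gr _ zin zu zv.
    by have [_ ->] := gr_v gr; apply: leq_subr.
  by rewrite mul2n -addnn leq_add ?le.
have cnt : t3 aCNT 0 = #|nodes (forest_tree n t2 aIN aLK)| by apply: count_nodes_spec.
have gt3 : graph_tables G X t3.
  by apply: graph_tables_eq (gr_tables gr); apply: fr3.
have t3low : t3 0 = s 0 by rewrite fr3 // fr2 // fr1.
have n0 : 0 < n by apply: leq_ltn_trans (ltn_ord u).
have min1 : minn 1 (2 * (n * n) + 1) = 1 by apply/minn_idPl; rewrite addn1.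
have runE : run n env' try_radii s =
  if t3 aCNT 0 + 1 - k != 0 then
    if (1 - t3 aFOUND 0) + (t3 aBD 0 - t3 aD 0) != 0 then run n env' record_tree t3
    else t3
  else t3.
  transitivity (run n env' (when (leq_exp (HIn (HConst 1)) (get aCNT))
    (when is_shorter record_tree)) t3).
    by [].
  by rewrite [LHS]/= min1 t3low s1.
have t3F : t3 aFOUND = s aFOUND by rewrite fr3 // fr2 // fr1.
have t3BD : t3 aBD = s aBD by rewrite fr3 // fr2 // fr1.
have t3D : t3 aD 0 = D by rewrite fr3 // (gr_D gr).
have t3inf : t3 aINF 0 = inf by rewrite fr3 // fr2 // fr1.
have t3U : t3 aU 0 = u by rewrite fr3 // fr2 // fr1.
have t3V : t3 aV 0 = v by rewrite fr3 // fr2 // fr1.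
have t3A : t3 aA = fA by rewrite fr3 // fr2 // fr1.
have t3B : t3 aB = fB by rewrite fr3 // fr2 // fr1.
have t3on : t3 aON = s aON by rewrite fr3 // fr2 // fr1.
have t3ol : t3 aOL = s aOL by rewrite fr3 // fr2 // fr1.
have t3in : t3 aIN = t2 aIN by rewrite fr3.
have t3lk : t3 aLK = t2 aLK by rewrite fr3.
have keep : best_so_far t3 /\ [/\ t3 aU 0 = u, t3 aV 0 = v, t3 aA = fA & t3 aB = fB].
  split; last by split.
  split=> //; first by rewrite t3low.
  by rewrite /forest_tree t3F t3BD t3on t3ol.
have keepM l : found_within l s -> found_within l t3.
  by rewrite /found_within t3F t3BD.
have succ : (exists2 W : {set 'I_n}, k <= #|W| &
     forall z, z \in W -> exists m, reach G X u v (D - fA i) (D - fB j) D z m) ->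
   k <= t3 aCNT 0.
  move=> [W kW Wr]; rewrite cnt; apply: leq_trans kW _; apply: subset_leq_card.
  by apply/subsetP => z /Wr [m /compl [zin _]]; rewrite inE.
have [r1 r2 r3] := record_tree_spec env' gt3.
have fr4 x : x \notin [:: aFOUND; aBD; aON; aOL] -> run n env' record_tree t3 x = t3 x.
  by move=> xN; apply: run_frame; exact: xN.
move: (run n env' record_tree t3) r1 r2 r3 fr4 runE => r r1 r2 r3 fr4 runE.
rewrite runE; case: eqP => [ck|/eqP ck] /=.
  split=> // l [_ /succ]; lia.
case: eqP => [sh|/eqP sh] /=.
  split=> // l [-> _]; case: keep => [[_ _ _ [F|[F _]]] _]; rewrite ?F // in sh *.
  split=> //; rewrite t3D in sh; lia.
split.
- split; last by rewrite !fr4.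
  split; [by apply: graph_tables_eq gt3; apply: fr4 | by rewrite fr4 // t3low | by rewrite fr4 |].
  right; split=> //; rewrite r2 r3 t3D /forest_tree t3in t3lk; split=> //.
  by rewrite -/(forest_tree n t2 aIN aLK) -cnt; lia.
- move=> l; rewrite /found_within r1 r2 -t3F -t3BD => -[F bl]; split=> //.
  rewrite F in sh; lia.
- by move=> l [-> _]; rewrite /found_within r1 r2 t3D.
Qed.


(* The label [inf] of one end exceeds the threshold [inf - 1], so that no path
   goes through that end. *)
Definition edge_candidate (u v : 'I_n) l := edge G u v /\
  exists (A B : {set 'I_n}) a b,
    [/\ [/\ u \in A, v \in B & k <= #|A :|: B|], a < inf /\ b < inf,
        forall z, z \in A -> exists2 m, m <= a & reach G X u v 0 inf (inf - 1) z m,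
        forall z, z \in B -> exists2 m, m <= b & reach G X u v inf 0 (inf - 1) z m &
        l = threshold a b (X u v)].

(** The radii [a] and [b] of a candidate need not be tried themselves: the largest computed labels
    over [A] and [B] are tried, are no larger, and still cover [A :|: B]. *)
Lemma try_edge_spec (u v : 'I_n) env :
  advances best_so_far found_within (edge_candidate u v)
    (run n [:: nat_of_ord v, nat_of_ord u & env] try_edge).
Proof.
set env' := [:: nat_of_ord v, nat_of_ord u & env] => s bs.
have [gs s1 sinf sF] := bs.
have runE : run n env' try_edge s = if edge G u v then run n env' (block
    [:: set aU (HVar 1); set aV (HVar 0); set aD (HSub (get aINF) (HConst 1));
       set aP (HConst 0); set aQ (get aINF); dijkstra; copy aA aE;
       set aP (get aINF); set aQ (HConst 0); dijkstra; copy aB aE;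
       CFor (CFor try_radii)]) s else s.
  transitivity (if s aED (u * n + v) != 0 then run n env' (block
    [:: set aU (HVar 1); set aV (HVar 0); set aD (HSub (get aINF) (HConst 1));
       set aP (HConst 0); set aQ (get aINF); dijkstra; copy aA aE;
       set aP (get aINF); set aQ (HConst 0); dijkstra; copy aB aE;
       CFor (CFor try_radii)]) s else s); last by rewrite (gt_edge gs).
  have evE : ev n env' s here = u * n + v by rewrite /= min0n (gt_n gs).
  by rewrite -evE.
case: (boolP (edge G u v)) runE => uv runE; last first.
  by rewrite runE; split=> // l [h]; rewrite h in uv.
pose t1 := run n env' (block [:: set aU (HVar 1); set aV (HVar 0);
  set aD (HSub (get aINF) (HConst 1)); set aP (HConst 0); set aQ (get aINF)]) s.
pose t2 := run n env' dijkstra t1; pose t3 := run n env' (copy aA aE) t2.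
pose t4 := run n env' (block [:: set aP (get aINF); set aQ (HConst 0)]) t3.
pose t5 := run n env' dijkstra t4; pose t6 := run n env' (copy aB aE) t5.
have {}runE : run n env' try_edge s = run n env' (CFor (CFor try_radii)) t6.
  by rewrite runE.
have fr1 x : x \notin [:: aU; aV; aD; aP; aQ] -> t1 x = s x.
  by move=> xN; apply: run_frame; exact: xN.
have fr2 x : x \notin writes dijkstra -> t2 x = t1 x by move=> xN; apply: run_frame.
have fr3 x : x \notin [:: aA] -> t3 x = t2 x.
  by move=> xN; apply: run_frame; exact: xN.
have fr4 x : x \notin [:: aP; aQ] -> t4 x = t3 x.
  by move=> xN; apply: run_frame; exact: xN.
have fr5 x : x \notin writes dijkstra -> t5 x = t4 x by move=> xN; apply: run_frame.
have fr6 x : x \notin [:: aB] -> t6 x = t5 x.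
  by move=> xN; apply: run_frame; exact: xN.
have [t1U t1V [t1D t1P t1Q]] : [/\ t1 aU 0 = u, t1 aV 0 = v &
    [/\ t1 aD 0 = inf - 1, t1 aP 0 = 0 & t1 aQ 0 = inf]].
  by rewrite /t1 /= /upd /= /update /= sinf.
have gt1 : graph_tables G X t1 by apply: graph_tables_eq gs; apply: fr1.
have Xl : X u v <= 0 + inf by apply: X_inf.
have Xr : X u v <= inf + 0 by rewrite addn0; apply: X_inf.
have [gr2 compl2] := dijkstra_spec X_sym uv Xl env' gt1 t1U t1V t1P t1Q t1D.
rewrite -/t2 in gr2 compl2.
have gt4 : graph_tables G X t4.
  by apply: graph_tables_eq (gr_tables gr2); rewrite fr4 // fr3.
have t4inf : t4 aP 0 = inf /\ t4 aQ 0 = 0.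
  rewrite /t4 /= /upd /= /update /= fr3 // fr2 // fr1 //.
have [t4P t4Q] := t4inf.
have t4D : t4 aD 0 = inf - 1 by rewrite fr4 // fr3 // fr2.
have t4U : t4 aU 0 = u by rewrite fr4 // fr3 // fr2.
have t4V : t4 aV 0 = v by rewrite fr4 // fr3 // fr2.
have [gr5 compl5] := dijkstra_spec X_sym uv Xr env' gt4 t4U t4V t4P t4Q t4D.
rewrite -/t5 in gr5 compl5.
have t6A (x : 'I_n) : t6 aA x = t2 aE x.
  by rewrite fr6 // fr5 // fr4 // /t3 copy_spec.
have t6B (x : 'I_n) : t6 aB x = t5 aE x by rewrite /t6 copy_spec.
have fr x : x \notin [:: aU; aV; aD; aP; aQ; aA; aB] -> x \notin writes dijkstra -> t6 x = s x.
  move=> xN xd; move: xN; rewrite !inE !negb_or.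
  move=> /and5P[x1 x2 x3 x4 /and3P[x5 x6 x7]].
  rewrite fr6; last by rewrite inE.
  rewrite fr5 // fr4; last by rewrite !inE negb_or x4.
  rewrite fr3; last by rewrite inE.
  by rewrite fr2 // fr1 // !inE !negb_or x1 x2 x3 x4.
have inv6 : best_so_far t6 /\ [/\ t6 aU 0 = u, t6 aV 0 = v, t6 aA = t6 aA & t6 aB = t6 aB].
  split; last by split=> //; rewrite fr6 // fr5.
  split; rewrite ?fr //.
    by apply: graph_tables_eq gt4; rewrite fr6 // fr5.
  by rewrite /forest_tree !fr.
pose Q i j l := let D := threshold (t6 aA i) (t6 aB j) (X u v) in l = D /\
  exists2 W : {set 'I_n}, k <= #|W| & forall z, z \in W ->
    exists m, reach G X u v (D - t6 aA i) (D - t6 aB j) D z m.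
have adv : advances
    (fun s => best_so_far s /\ [/\ s aU 0 = u, s aV 0 = v, s aA = t6 aA & s aB = t6 aB])
    found_within (fun l => exists2 i, i < n & exists2 j, j < n & Q i j l)
    (run n env' (CFor (CFor try_radii))).
  apply: advances_iteri => i _; apply: advances_iteri => j _; exact: try_radii_spec.
have [[bs6 _] M6 Q6] := adv t6 inv6.
rewrite -runE in bs6.
have M6' l : found_within l t6 -> found_within l (run n env' try_edge s).
  by rewrite runE; apply: M6.
split=> // [l [F bl]|l].
  by apply: M6'; rewrite /found_within !fr.
case=> _ [A [B [a [b [[uA vB kAB] [ainf binf] Ar Br ->]]]]].
pose z1 := [arg max_(z > u in A) t6 aA z]; pose z2 := [arg max_(z > v in B) t6 aB z].
have [z1A z1max] : z1 \in A /\ forall z, z \in A -> t6 aA z <= t6 aA z1.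
  by rewrite /z1; case: arg_maxnP.
have [z2B z2max] : z2 \in B /\ forall z, z \in B -> t6 aB z <= t6 aB z2.
  by rewrite /z2; case: arg_maxnP.
have Ale z : z \in A -> t6 aA z <= a /\ reach G X u v 0 inf (inf - 1) z (t6 aA z).
  case/Ar => m ma /compl2 [zin zm]; rewrite t6A; split; first exact: leq_trans ma.
  exact: gr_reach gr2 _ zin.
have Ble z : z \in B -> t6 aB z <= b /\ reach G X v u 0 inf (inf - 1) z (t6 aB z).
  case/Br => m mb /compl5 [zin zm]; rewrite t6B; split; first exact: leq_trans mb.
  exact: reach_swap (gr_reach gr5 zin).
set D := threshold (t6 aA z1) (t6 aB z2) (X u v).
have DA : t6 aA z1 <= D by rewrite /D /threshold !leq_max leqnn orbT.
have DB : t6 aB z2 <= D by rewrite /D /threshold !leq_max leqnn !orbT.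
have Dab : D <= threshold a b (X u v).
  have [za _] := Ale _ z1A; have [zb _] := Ble _ z2B.
  rewrite /D /threshold !geq_max !leq_max za zb !orbT !andbT.
  by apply/orP; left; apply/orP; left; apply: leq_div2r; lia.
suff : found_within D (run n env' try_edge s).
  by case=> h1 h2; split=> //; apply: leq_trans Dab.
rewrite runE; apply: Q6; exists z1 => //; exists z2 => //; split=> //.
(* A node of [A] has a label at most that of [z1], so after the shift its label is at most [D];
   likewise for [B] and [z2]. *)
exists (A :|: B) => // z; rewrite inE => /orP[zA|zB].
  have [za zr] := Ale _ zA; exists ((D - t6 aA z1) + t6 aA z).
  apply: reach_shift zr _ _; first exact: leq_ltn_trans ainf.
  by have := z1max _ zA; lia.
have [zb zr] := Ble _ zB; exists ((D - t6 aB z2) + t6 aB z).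
apply: reach_swap; apply: reach_shift zr _ _; first exact: leq_ltn_trans binf.
by have := z2max _ zB; lia.
Qed.

End Main.

(** * Rational and integer lengths *)

Lemma nat_max_exists (P : nat -> Prop) b : (exists m, P m) ->
  (forall m, P m -> m <= b) -> exists2 m, P m & forall m', P m' -> m' <= m.
Proof.
move=> Pex; elim: b => [|b IH] Pb.
  by have [m Pm] := Pex; exists m => // m' /Pb; rewrite leqn0 => /eqP->.
case: (classic (P b.+1)) => Pb1; first by exists b.+1.
apply: IH => m Pm; have := Pb m Pm; rewrite leq_eqVlt ltnS.
by case/orP=> // /eqP mb; rewrite -mb in Pb1.
Qed.

Section Scaling.
Variables (n : nat) (G : wgraph n) (X : 'I_n -> 'I_n -> nat) (L inf k : nat).
Hypothesis L_gt0 : 0 < L.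
Hypothesis X_scale : forall x y, edge G x y ->
  ((X x y)%:R = 2%:R * L%:R * weight G x y :> rat)%R.
Hypothesis X_even : forall x y, ~~ odd (X x y).
Hypothesis X_inf : forall x y, edge G x y -> n * X x y < inf.
Hypothesis inf_gt0 : 0 < inf.

Lemma scaled_sym x y : edge G x y -> X x y = X y x.
Proof.
move=> xy; apply/eqP; rewrite -(eqr_nat rat) !X_scale //; last by rewrite edge_sym.
by rewrite weight_sym.
Qed.

Lemma scaled_length x p : path (edge G) x p ->
  ((int_length X x p)%:R = 2%:R * L%:R * path_length G x p :> rat)%R.
Proof.
elim: p x => [|y p IH] x /=; first by rewrite /int_length /path_length !big_nil mulr0.
case/andP=> xy yp; rewrite int_length_cons natrD IH // X_scale //.
by rewrite /path_length /= big_cons mulrDr.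
Qed.

Lemma leq_scaled_length x p x' p' : path (edge G) x p -> path (edge G) x' p' ->
  (int_length X x p <= int_length X x' p') = (path_length G x p <= path_length G x' p')%R.
Proof.
move=> xp xp'; rewrite -(ler_nat rat) !scaled_length // ler_pM2l //.
by rewrite mulr_gt0 // ltr0n.
Qed.

Lemma int_length_even x p : ~~ odd (int_length X x p).
Proof.
elim: p x => [|y p IH] x; first by rewrite /int_length big_nil.
by rewrite int_length_cons oddD (negPf (X_even x y)) (negPf (IH y)).
Qed.

(** Fewer than [n] edges, each with [n] times its weight at most [inf - 1]; comparing [n] times the
    length avoids a division. *)
Lemma int_length_lt x p : path (edge G) x p -> uniq (x :: p) -> int_length X x p < inf.
Proof.
move=> xp up; have sp : size p < n.
  by have := max_card (mem (x :: p)); rewrite card_ord (card_uniqP up).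
have H : n * int_length X x p <= size p * (inf - 1).
  elim: p x xp {up sp} => [|y p IH] x /=; first by rewrite /int_length big_nil muln0.
  case/andP=> xy yp; rewrite int_length_cons mulnDr mulSn leq_add ?IH //.
  by have := X_inf xy; lia.
have : n * int_length X x p <= n * (inf - 1).
  by apply: leq_trans H _; rewrite leq_mul2r ltnW ?orbT.
by rewrite leq_pmul2l; lia.
Qed.

Lemma path_between_edges T x y p : is_subgraph G T -> path_between T x y p ->
  path (edge G) x p.
Proof.
by move=> [_ subT] [xp _ _]; apply: sub_path xp => a b /subT /and3P[].
Qed.

(** Scaled path lengths are natural numbers below [inf], so a largest one exists. *)
Lemma diameter_exists T : is_subgraph G T -> is_tree T -> exists d, is_diameter G T d.
Proof.
move=> subT [[/set0Pn [x0 x0T] _] _].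
pose P m := exists x y p, [/\ x \in nodes T, y \in nodes T, path_between T x y p &
  int_length X x p = m].
have [||m [x [y [p [xT yT xy xm]]]] mmax] := @nat_max_exists P inf.
- by exists (int_length X x0 [::]), x0, x0, [::].
- move=> m [x [y [p [_ _ xy <-]]]]; apply: ltnW; apply: int_length_lt.
    exact: path_between_edges xy.
  by case: xy.
exists (path_length G x p); split; first by exists x, y, p.
move=> x' y' p' x'T y'T xy'.
rewrite -leq_scaled_length; [|exact: path_between_edges xy'|exact: path_between_edges xy].
by rewrite xm; apply: mmax; exists x', y', p'.
Qed.

Lemma diameter_ge0 T d : is_subgraph G T -> is_diameter G T d -> (0 <= d)%R.
Proof.
move=> subT [[x [y [p [_ _ xy <-]]]] _].
have := path_between_edges subT xy; rewrite /path_length.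
elim: p x {xy} => [|z p IH] x /=; first by rewrite big_nil.
by case/andP=> xz zp; rewrite big_cons addr_ge0 ?IH ?weight_ge0.
Qed.

Lemma ktree_candidate T d : 1 < k -> is_ktree G k T -> is_diameter G T d ->
  exists u v l, edge_candidate G X inf k u v l /\ (l%:R <= L%:R * d)%R.
Proof.
move=> k1 [subT treeT kT] [[x [y [p [xT yT xy pd]]]] dmax].
have xp := path_between_edges subT xy.
have [|||u [v [A [B [a [b [[uv abX a2 b2] [uA vB TAB] Ap Bp]]]]]]] :=
  @center_edge n G X scaled_sym T (int_length X x p) subT treeT.
- exact: leq_trans kT.
- by exists x, y, p.
- move=> x' y' p' x'T y'T xy'; rewrite leq_scaled_length //; last exact: path_between_edges xy'.
  by rewrite pd; apply: dmax xy'.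
have p_inf : int_length X x p < inf by apply: int_length_lt => //; case: xy.
exists u, v, (threshold a b (X u v)); split.
- split=> //; exists A, B, a, b; split=> //.
  + by split=> //; apply: leq_trans kT (subset_leq_card TAB).
  + by split; lia.
  + move=> z /Ap [q [uq ql uniq_q vq qa]]; exists (int_length X u q) => //.
    by rewrite -ql -[X in reach _ _ _ _ _ _ _ _ X]add0n; apply: reach_path => //; lia.
  + move=> z /Bp [q [uq ql uniq_q vq qb]]; exists (int_length X v q) => //.
    rewrite -ql -[X in reach _ _ _ _ _ _ _ _ X]add0n.
    by apply: reach_swap; apply: reach_path => //; lia.
(* The length of the longest path is even, so rounding up the half of [a + b + X u v] does not
   exceed its half. *)
- have th : 2 * threshold a b (X u v) <= int_length X x p.
    have := int_length_even x p; rewrite /threshold; move: (int_length X x p) abX a2 b2 => m; lia.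
  have := scaled_length xp; rewrite pd -(ler_nat rat) natrM in th * => E.
  by move: th; rewrite E -mulrA ler_pM2l ?ltr0n.
Qed.

(** [d / L] is squeezed in between: the diameter of [T] is at most [d / L], which is at most every
    competing diameter. The factor 2 of the scaling cancels against that of [2 * d]. *)
Lemma min_diameter_of_good T d : good_tree G X k d T ->
  (forall T' d', is_ktree G k T' -> is_diameter G T' d' -> (d%:R <= L%:R * d')%R) ->
  is_min_diameter_ktree G k T.
Proof.
move=> [[subT treeT lenT] kT] H.
split; first by [].
have [d' dT] := diameter_exists subT treeT; exists d' => // T' d'' kT' dT'.
apply: le_trans (_ : (d%:R / L%:R <= _)%R); last first.
  by rewrite ler_pdivrMr ?ltr0n // mulrC; apply: H dT'.
have [[x [y [p [xT yT xy <-]]]] _] := dT.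
rewrite ler_pdivlMr ?ltr0n // mulrC.
have := lenT x y p xT yT xy; rewrite -(ler_nat rat) scaled_length.
2: exact: path_between_edges xy.
by rewrite natrM -mulrA ler_pM2l ?ltr0n.
Qed.

End Scaling.

(** * Encodings *)

(** The answer overwrites the input word from cell 1 on, when of that word only [n] in cell 0 is
    still read. *)
Definition emit :=
  CSeq (CFor (COut (HVar 0) (HArr aON (HVar 0))))
       (CFor (CFor (COut (HAdd (HIn (HConst 0)) here) (HArr aOL here)))).

Lemma emit_spec n env s (s' := run n env emit s) : s 0 0 = n ->
  [/\ s' 0 0 = n, forall i, i < n -> s' 0 (1 + i) = (s aON i != 0) &
    forall i j, i < n -> j < n ->
      s' 0 (1 + (n + (i * n + j))) = (s aOL (i * n + j) != 0)].
Proof.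
move=> s0n.
(* Both segments of the output as one function: any write at offset [e] stores [f e], so the second
   loop cannot spoil the first segment. *)
pose f e := if e < n then s aON e != 0 else s aOL (e - n) != 0.
pose I (t : state) := [/\ t 0 0 = n, t aON = s aON & t aOL = s aOL].
pose M e (t : state) := t 0 (1 + e) = f e.
have boolE x : 1 - (1 - x) = (x != 0) by case: x => // x; rewrite subSS sub0n.
have step e x (t : state) : I t -> (x != 0) = f e ->
    [/\ I (upd t 0 (1 + e) (1 - (1 - x))),
      forall l, M l t -> M l (upd t 0 (1 + e) (1 - (1 - x))) &
      forall l, l = e -> M l (upd t 0 (1 + e) (1 - (1 - x)))].
  move=> [tn tON tOL] xf; rewrite boolE /M /upd /= /update; split=> // l.
    by move=> tl; rewrite eqn_add2l; case: eqP => [->|//]; rewrite xf.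
  by move=> ->; rewrite eqxx xf.
have adv1 : advances I M (fun l => exists2 i, i < n & l = i)
    (run n env (CFor (COut (HVar 0) (HArr aON (HVar 0))))).
  apply: advances_iteri => i lin t It.
  have E : run n (i :: env) (COut (HVar 0) (HArr aON (HVar 0))) t =
      upd t 0 (1 + i) (1 - (1 - s aON i)).
    have [_ tON _] := It; rewrite /= tON; congr (upd _ _ (1 + _) _).
    by apply/minn_idPl; nia.
  have fi : (s aON i != 0) = f i by rewrite /f lin.
  by have := step i (s aON i) t It fi; rewrite -E.
have adv2 : advances I M (fun l => exists2 i, i < n & exists2 j, j < n & l = n + (i * n + j))
    (run n env (CFor (CFor (COut (HAdd (HIn (HConst 0)) here) (HArr aOL here))))).
  apply: advances_iteri => i lin; apply: advances_iteri => j ljn t It.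
  have E : run n [:: j, i & env] (COut (HAdd (HIn (HConst 0)) here) (HArr aOL here)) t =
      upd t 0 (1 + (n + (i * n + j))) (1 - (1 - s aOL (i * n + j))).
    have [tn _ tOL] := It; rewrite /= !min0n tn tOL; congr (upd _ _ (1 + _) _).
    by apply/minn_idPl; have := entry_lt lin ljn; nia.
  have fe : (s aOL (i * n + j) != 0) = f (n + (i * n + j)).
    by rewrite /f ltnNge leq_addr /= addKn.
  by have := step _ (s aOL (i * n + j)) t It fe; rewrite -E.
have I0 : I s by split.
have [I1 _ Q1] := adv1 s I0.
have [[s'n _ _] M2 Q2] := adv2 _ I1.
split=> [|i lin|i j lin ljn]; first exact: s'n.
  by have := M2 i (Q1 i (ex_intro2 _ _ i lin erefl)); rewrite /M /f lin.
have := Q2 _ (ex_intro2 _ _ i lin (ex_intro2 _ _ j ljn erefl)).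
by rewrite /M /f ltnNge leq_addr /= addKn.
Qed.

(** The loop merely tests [0 < n]: each iteration records the same tree, node 0 without links. The
    bound [aBD] is still 0, the diameter of a point. *)
Lemma single_node_spec n (G : wgraph n) X inf k env s (s' := run n env single_node s) :
  0 < k -> best_so_far G X inf k s -> s aFOUND 0 = 0 -> s aBD 0 = 0 ->
  (forall x, s aON x = 0) -> (forall e, s aOL e = 0) ->
  best_so_far G X inf k s' /\ (k <= 1 -> 0 < n -> found_within 0 s').
Proof.
move=> k0 bs F0 B0 ON0 OL0; have [gs s1 sinf _] := bs.
pose P i (t : state) := [/\ t 0 = s 0,
  if (0 < i) && (k <= 1) then t aFOUND 0 = 1 /\ t aON 0 = 1 else t aFOUND 0 = 0 &
  forall x, 0 < x -> t aON x = 0].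
have [_ s'F s'ON] : P n s'.
  apply: (iteri_inv (P := P)) => [|i t lin [t0 tF tON]]; first by split.
  have min1 : minn 1 (2 * (n * n) + 1) = 1 by apply/minn_idPl; rewrite addn1.
  rewrite /P /= min1 t0 s1 /=; case: (leqP k 1) tF => k1 tF.
    have -> : 2 - k != 0 by lia.
    rewrite /upd /= /update /=; split=> // x x0.
    by rewrite gtn_eqF // tON.
  have -> : (2 - k != 0) = false by lia.
  by rewrite andbF in tF.
have fr x : x \notin [:: aFOUND; aON] -> s' x = s x.
  by move=> xN; apply: run_frame; exact: xN.
have gs' : graph_tables G X s' by apply: graph_tables_eq gs; apply: fr.
case: (boolP ((0 < n) && (k <= 1))) s'F => [/andP[n0 k1] [F1 ON1]|nk F].
  split; last by move=> _ _; rewrite /found_within F1 fr // B0.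
  split; [by [] | by rewrite fr | by rewrite fr | right; split=> //].
  have -> : forest_tree n s' aON aOL = point_tree (Ordinal n0).
    rewrite /forest_tree /point_tree; congr Subgraph.
      apply/setP=> x; rewrite !inE -(inj_eq val_inj) /=.
      by case: (posnP x) => [->|x0]; [rewrite ON1 | rewrite s'ON // gtn_eqF].
    apply: functional_extensionality => x; apply: functional_extensionality => y.
    by rewrite fr // OL0.
  by split; [exact: point_tree_within | rewrite cards1].
split; last by move=> k1 n0; rewrite n0 k1 in nk.
by split; [| rewrite fr | rewrite fr | left].
Qed.

Lemma nth_allpairs (S T R : Type) (f : S -> T -> R) s t x0 y0 z0 i j :
  i < size s -> j < size t ->
  nth z0 [seq f x y | x <- s, y <- t] (i * size t + j) = f (nth x0 s i) (nth y0 t j).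
Proof.
move=> si tj; elim: s i si => // x s IH [|i] si /=; rewrite nth_cat size_map.
  by rewrite tj (nth_map y0).
by rewrite mulSn -addnA ltnNge leq_addr /= addKn IH.
Qed.

Lemma nth_flatten_pairs (ss : seq (seq nat)) e b : all (fun s => size s == 2) ss ->
  e < size ss -> b < 2 -> nth 0 (flatten ss) (b + (e + e)) = nth 0 (nth [::] ss e) b.
Proof.
move=> ss2 es b2; elim: ss ss2 e es => //= s ss IH /andP[/eqP s2 ss2] [|e] es.
  by rewrite nth_cat s2 !addn0 b2.
rewrite nth_cat s2 ifF; last by lia.
by rewrite -(IH ss2 e es); congr nth; lia.
Qed.

Lemma encode_wgraph_entry n (G : wgraph n) (x y : 'I_n) b : b < 2 ->
  nth 0 (encode_wgraph G) (b + ((x * n + y) + (x * n + y))) =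
  nth 0 (if edge G x y then [:: `|numq (weight G x y)|%N; `|denq (weight G x y)|%N]
         else [:: 0; 0]) b.
Proof.
move=> b2; pose f i j := if edge G i j then
  [:: `|numq (weight G i j)|%N; `|denq (weight G i j)|%N] else [:: 0; 0].
rewrite -/(f x y) /encode_wgraph -/f.
have -> : [seq (if edge G i j then [:: `|numq (weight G i j)|%N; `|denq (weight G i j)|%N]
  else [:: 0; 0]) | i <- enum 'I_n, j <- enum 'I_n] =
  [seq f i j | i <- enum 'I_n, j <- enum 'I_n] by [].
have sz : size (enum 'I_n) = n by rewrite size_enum_ord.
rewrite nth_flatten_pairs //.
- have := @nth_allpairs _ _ _ f (enum 'I_n) (enum 'I_n) x y [::] x y.
  by rewrite sz !nth_ord_enum => ->.
- by apply/all_allpairsP => i j _ _; rewrite /f; case: ifP.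
- by rewrite size_allpairs sz; apply: entry_lt.
Qed.

Lemma size_encode_wgraph n (G : wgraph n) : size (encode_wgraph G) = 2 * (n * n).
Proof.
rewrite /encode_wgraph size_flatten /shape.
set s := [seq _ | i <- enum 'I_n, j <- enum 'I_n].
have h : all (pred1 2) (map size s).
  by rewrite all_map; apply/all_allpairsP => i j _ _ /=; case: ifP.
rewrite (all_pred1P _ _ h) size_map size_allpairs size_enum_ord sumn_nseq //.
Qed.

(** * Correctness of the whole search *)

Definition search_edges := CFor (CFor try_edge).

Definition solver :=
  block [:: scale; tabulate; infinity; single_node; search_edges; emit].

Lemma nth_encode_subgraph n (T : subgraph n) (i j : 'I_n) :
  nth 0 (encode_subgraph T) i = (i \in nodes T) /\
  nth 0 (encode_subgraph T) (n + (i * n + j)) = links T i j.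
Proof.
have sz : size (enum 'I_n) = n by rewrite size_enum_ord.
rewrite /encode_subgraph; split.
  rewrite nth_cat size_map sz ltn_ord (nth_map i) ?sz //.
  by rewrite nth_ord_enum.
rewrite nth_cat size_map sz ltnNge leq_addr /= addKn.
have := @nth_allpairs _ _ _ (fun i j => links T i j : nat) (enum 'I_n) (enum 'I_n) i j 0 i j.
by rewrite sz !nth_ord_enum => ->.
Qed.

Lemma size_encode_subgraph n (T : subgraph n) : size (encode_subgraph T) = n + n * n.
Proof. by rewrite size_cat size_map size_allpairs !size_enum_ord. Qed.

Lemma solver_correct (I : ktree_instance) (n := node_count I)
    (s := run n [::] solver (initial_state (encode_instance I))) :
  exists w, [/\ ktree_answer I w, size w <= 2 + 2 * (n * n) &
    forall i, i < size w ->
      nth 0 w i = if i == 0 then nat_of_bool (s aFOUND 0 != 0) else s 0 i].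
Proof.
set G := graph I; set k := bound I; have k0 : 0 < k := bound_gt0 I.
pose s0 := initial_state (encode_instance I).
pose num e := s0 0 (2 + (e + e)); pose den e := s0 0 (3 + (e + e)).
pose sa := run n [::] (block [:: scale; tabulate; infinity]) s0.
pose sb := run n [::] single_node sa; pose sc := run n [::] search_edges sb.
have sE : s = run n [::] emit sc by [].
have numE (x y : 'I_n) : edge G x y -> num (x * n + y) = `|numq (weight G x y)|%N.
  by move=> xy; have := @encode_wgraph_entry n G x y 0 isT; rewrite xy.
have denE (x y : 'I_n) : edge G x y -> den (x * n + y) = `|denq (weight G x y)|%N.
  by move=> xy; have := @encode_wgraph_entry n G x y 1 isT; rewrite xy.
have den_edge (x y : 'I_n) : (den (x * n + y) != 0) = edge G x y.
  case: (boolP (edge G x y)) => xy; first by rewrite denE // absz_eq0 denq_eq0.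
  have := @encode_wgraph_entry n G x y 1 isT; rewrite (negPf xy) /= => E.
  by rewrite [den _]E.
have [fr1 L0 Ldvd] := @scale_spec n s0 erefl [::].
set L := run n [::] scale s0 aL 0 in L0.
have [sa0 _ saED saX] := @tables_spec n s0 erefl (fun=> erefl).
rewrite -/sa in sa0 saED saX.
pose X (x y : 'I_n) := (L %/ den (x * n + y) * num (x * n + y)).*2.
have X_even x y : ~~ odd (X x y) by rewrite /X odd_double.
have X_scale (x y : 'I_n) : edge G x y ->
    ((X x y)%:R = 2%:R * L%:R * weight G x y :> rat)%R.
  move=> xy; have dvd : den (x * n + y) %| L by apply: Ldvd; rewrite ?den_edge.
  have w0 := weight_ge0 xy.
  rewrite /X -mul2n !natrM -mulrA; congr (_ * _)%R.
  rewrite -{2}(divnK dvd) natrM -mulrA; congr (_ * _)%R.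
  rewrite -[weight G x y in RHS]divq_num_den mulrCA numE // denE //.
  rewrite !pmulrn (gez0_abs (denq_ge0 _)) gez0_abs ?numq_ge0 //.
  by rewrite mulfV ?mulr1 // intr_eq0 denq_eq0.
have X_sa (x y : 'I_n) : edge G x y -> sa aX (x * n + y) = X x y.
  by move=> xy; have [] := saX x y (ltn_ord x) (ltn_ord y); rewrite ?den_edge.
set inf := sa aINF 0.
have X_inf (x y : 'I_n) : edge G x y -> n * X x y < inf.
  by move=> xy; have [] := saX x y (ltn_ord x) (ltn_ord y); rewrite ?den_edge.
have inf_gt0 : 0 < inf.
  by rewrite /inf /sa /= /upd /= /update /= addn1.
have X_sym x y : edge G x y -> X x y = X y x by move=> xy; exact: (scaled_sym X_scale).
have fr x : x \notin [:: aL; aL; aED; aX; aINF; aINF] -> sa x = s0 x.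
  by move=> xN; apply: run_frame; exact: xN.
have bsa : best_so_far G X inf k sa.
  split=> //; first split.
  - by rewrite sa0.
  - by move=> x y; rewrite saED //; exact: den_edge.
  - exact: X_sa.
  - by rewrite sa0.
  - by left; rewrite fr.
have [||||bsb single] := single_node_spec [::] k0 bsa; rewrite ?fr //.
rewrite -/sb in bsb single.
have X_inf' (x y : 'I_n) : edge G x y -> X x y <= inf.
  move=> xy; apply: leq_trans (ltnW (X_inf _ _ xy)); apply: leq_pmull.
  exact: leq_ltn_trans (ltn_ord x).
have advc : advances (best_so_far G X inf k) found_within
    (fun l => exists2 i, i < n & exists2 j, j < n & exists u v : 'I_n,
      [/\ u = i :> nat, v = j :> nat & edge_candidate G X inf k u v l])
    (run n [::] search_edges).
  apply: advances_iteri => i lin; apply: advances_iteri => j ljn t bt.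
  have [h1 h2 h3] := try_edge_spec X_sym X_inf' (Ordinal lin) (Ordinal ljn) [::] bt.
  split=> // l [u [v [ui vj cand]]]; apply: h3.
  have -> : Ordinal lin = u by apply: val_inj.
  by have -> : Ordinal ljn = v by apply: val_inj.
have [[gsc _ _ scF] Mc Qc] := advc sb bsb; rewrite -/sc in gsc scF Mc Qc.
(* Completeness: every admissible tree forces a recorded value no larger than its own. It gives
   minimality of the recorded tree and, if none is recorded, that no admissible tree exists. *)
have found T d : is_ktree G k T -> is_diameter G T d ->
    exists2 l, found_within l sc & (l%:R <= L%:R * d)%R.
  move=> kT dT; case: (leqP k 1) => k1; last first.
    have [u [v [l [cand ld]]]] := ktree_candidate L0 X_scale X_even X_inf inf_gt0 k1 kT dT.
    by exists l => //; apply: Qc; exists u => //; exists v => //; exists u, v.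
  have [subT [[/set0Pn [x xT] _] _] _] := kT.
  exists 0; first by apply/Mc/single => //; apply: leq_ltn_trans (ltn_ord x).
  by rewrite mulr_ge0 ?ler0n // (diameter_ge0 subT dT).
have [sn sON sOL] := emit_spec [::] (gt_n gsc); rewrite -sE in sn sON sOL.
have sF : s aFOUND = sc aFOUND by rewrite sE; apply: run_frame.
case: scF => [F0|[F1 good]].
  exists [:: 0]; split=> //; last by case=> // _; rewrite sF F0.
  right; split=> // T kT; have [subT treeT _] := kT.
  have [d dT] := diameter_exists L0 X_scale X_inf inf_gt0 subT treeT.
  by have [l [F1 _] _] := found T d kT dT; rewrite F0 in F1.
set T := forest_tree n sc aON aOL in good.
exists (1 :: encode_subgraph T); split.
- left; exists T => //.
  apply: (min_diameter_of_good L0 X_scale X_inf inf_gt0 good) => T' d' kT' dT'.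
  have [l [_ bl] ld] := found T' d' kT' dT'.
  by apply: le_trans ld; rewrite ler_nat.
- by rewrite /= size_encode_subgraph; nia.
- case=> [|i]; first by rewrite /= sF F1.
  rewrite /= size_encode_subgraph ltnS => lin.
  case: (ltnP i n) => i_n.
    have [-> _] := nth_encode_subgraph T (Ordinal i_n) (Ordinal i_n).
    by rewrite inE -[i.+1]add1n sON.
  have en : i - n < n * n by rewrite ltn_subLR.
  have n0 : 0 < n by case: (n) en.
  have xn : (i - n) %/ n < n by rewrite ltn_divLR.
  have yn : (i - n) %% n < n by rewrite ltn_mod.
  have [_] := nth_encode_subgraph T (Ordinal xn) (Ordinal yn).
  rewrite /= -divn_eq subnKC // => ->.
  by have := sOL _ _ xn yn; rewrite -divn_eq subnKC // add1n => ->.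
Qed.

Theorem theorem1p7 : poly_time_solvable encode_instance ktree_answer.
Proof.
(* The arrays are numbered up to 24, and slot 0 of each block of 25 cells is for loop counters. *)
apply: (@poly_time_by_cmd _ _ _ solver 25 aFOUND) => // I.
exists (node_count I); split=> //; last exact: solver_correct.
by rewrite /= size_encode_wgraph.
Qed.
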